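(* There is a universal constant $c>0$, and for every real $\gamma$ with $0<\gamma\le2$ a constant $c_\gamma>0$ depending only on $\gamma$, such that the following holds. Let $\alpha>0$ be a real number, $p\ge2$ an integer, and $\phi:=p/(p+\alpha)$. Then $$\mathrm{dist}(\mu_p^{(\alpha)},\mu_\phi^+)\le c\,p^{-1}\log p\qquad\text{and}\qquad \mathrm{dist}_\gamma(\mu_p^{(\alpha)},\mu_\phi^+)\le c_\gamma\,p^{-\gamma/2}(\log p)^{\gamma/2}\quad(0<\gamma\le 2).$$ Moreover, for any interval $I$ in $\mathbb{R}$, $$|\mu_p^{(\alpha)}(I)-\mu_\phi^+(I)|\le c(1-\phi)^{-1}p^{-1/2}(\log p)^{1/2}.$$
   Context: The generalized Laguerre polynomial is $L_p^{(\alpha)}(z):=\sum_{k=0}^p\binom{p+\alpha}{p-k}\frac{(-z)^k}{k!}$ with generalized binomial coefficients, i.e. $\binom{x}{m}:=\frac{x(x-1)\cdots(x-m+1)}{m!}$. For $\alpha>0$ its zeros are real and positive. Let $a_1,\dots,a_p$ be the zeros of the rescaled polynomial $z\mapsto L_p^{(\alpha)}((p+\alpha)z)$ and $\mu_p^{(\alpha)}:=\frac1p(\delta_{a_1}+\cdots+\delta_{a_p})$ their empirical measure. For $\phi\in(0,1]$, put $a:=(1-\sqrt\phi)^2$, $b:=(1+\sqrt\phi)^2$, and let $\mu_\phi^+$ be the probability measure supported on $[a,b]$ given by $\mu_\phi^+:=\frac{1}{2\pi\phi t}\sqrt{(t-a)(b-t)_+}\,dt$, where $x_+:=\max(x,0)$.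 For a positive measure $\mu$ with compact support in $\mathbb{C}$, its logarithmic potential is $u(z):=\int_{\mathbb{C}}\log|z-w|\,d\mu(w)$. For probability measures $\mu,\mu'$ with compact support in $\mathbb{C}$ and logarithmic potentials $u,u'$, define $$\mathrm{dist}(\mu,\mu'):=\int_{\mathbb{P}^1}|u-u'|\,\omega_{FS},$$ where $\mathbb{P}^1=\mathbb{C}\cup\{\infty\}$ is the Riemann sphere and $\omega_{FS}:=dd^c\log(1+|z|^2)^{1/2}$, $dd^c:=\frac{i}{\pi}\partial\overline\partial$ (on $\mathbb{C}$ it equals $\frac{1}{\pi(1+|z|^2)^2}$ times Lebesgue measure), and for $\gamma>0$ $$\mathrm{dist}_\gamma(\mu,\mu'):=\sup\Big\{\Big|\int\varphi\,d\mu-\int\varphi\,d\mu'\Big| : \varphi\ \text{a } \mathcal{C}^\gamma\text{ function on }\mathbb{P}^1\text{ with }\|\varphi\|_{\mathcal{C}^\gamma}\le1\Big\},$$ where $\|\cdot\|_{\mathcal{C}^\gamma}$ is a fixed standard $\mathcal{C}^\gamma$ (Hölder) norm on $\mathbb{P}^1$. *)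

(* Defs.v *)
From HB Require Import structures.
From mathcomp Require Import all_boot all_order all_algebra.
From mathcomp Require Import complex.
From mathcomp Require Import all_classical all_reals all_analysis.
From mathcomp Require Import measurable_realfun.

Set Implicit Arguments.
Unset Strict Implicit.
Unset Printing Implicit Defensive.

Import Order.TTheory GRing.Theory Num.Theory.
Import numFieldNormedType.Exports.

Local Open Scope classical_set_scope.
Local Open Scope ring_scope.

(* The complex plane is the product R * R, which carries the product
   sigma-algebra and a normed-module structure over R.  The library norm of
   R * R is the sup norm, hence the separate Euclidean modulus. *)
Section plane.
Context {R : realType}.

Definition modulus (z : R * R) : R := Num.sqrt (z.1 ^+ 2 + z.2 ^+ 2).

Definition plane_inv (z : R * R) : R * R :=
  (z.1 / (modulus z) ^+ 2, - z.2 / (modulus z) ^+ 2).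

Definition plane_of_complex (z : complex R) : R * R :=
  (complex.Re z, complex.Im z).

Definition real_axis (t : R) : R * R := (t, 0).

Lemma measurable_real_axis : measurable_fun [set: R] real_axis.
Proof.
by apply/measurable_fun_pairP; split; [exact: measurable_id|exact: measurable_cst].
Qed.

End plane.

Section laguerre.
Context {R : realType}.
Implicit Types (p : nat) (alpha : R).

Definition gbinom (x : R) (m : nat) : R :=
  (\prod_(i < m) (x - i%:R)) / (m`!)%:R.

Definition laguerre p alpha : {poly R} :=
  \poly_(k < p.+1) (gbinom (p%:R + alpha) (p - k) * (-1) ^+ k / (k`!)%:R).

Definition rescaled_laguerre p alpha : {poly R} :=
  laguerre p alpha \Po ((p%:R + alpha) *: 'X).

(* The complex zeros of q, repeated according to multiplicity: q is its leading
   coefficient times the product of the 'X - z over this sequence. *)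
Definition complex_zeros (q : {poly R}) : seq (complex R) :=
  sval (closed_field_poly_normal (map_poly (real_complex R) q)).

Definition laguerre_zero p alpha (i : nat) : R * R :=
  plane_of_complex (nth 0 (complex_zeros (rescaled_laguerre p alpha)) i).

(* For alpha > 0 the rescaled polynomial has degree p, so that
   laguerre_zero p alpha i, for i < p, lists all its zeros. *)
Definition laguerre_measure p alpha : {measure set (R * R) -> \bar R} :=
  mscale (p%:R^-1)%:nng (msum (fun i => dirac (laguerre_zero p alpha i)) p).

End laguerre.

Section marchenko_pastur.
Context {R : realType}.
Variable phi : R.

Definition mp_left : R := (1 - Num.sqrt phi) ^+ 2.
Definition mp_right : R := (1 + Num.sqrt phi) ^+ 2.

Definition mp_density (t : R) : R :=
  \1_(`[mp_left, mp_right]) t *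
  (Num.sqrt (Num.max ((t - mp_left) * (mp_right - t)) 0) / (2 * pi * phi * t)).

(* The density is nonnegative as soon as phi >= 0; taking its positive part
   only serves to have a measure for every real phi. *)
Definition mp_line (A : set R) : \bar R :=
  (\int[lebesgue_measure]_(t in A) (Num.max (mp_density t) 0)%:E)%E.

Definition mp_measure (A : set (R * R)) : \bar R := pushforward mp_line real_axis A.

Lemma measurable_mp_density : measurable_fun [set: R] mp_density.
Proof.
have minv : measurable_fun [set: R] (fun t : R => t^-1).
  rewrite (_ : (fun t => _) = (fun t => t * (t ^+ 2) `^ (-1))); last first.
    apply/funext => t; rewrite powR_inv1 ?sqr_ge0//.
    have [->|t0] := eqVneq t 0; first by rewrite invr0 mul0r.
    by rewrite expr2 invfM mulrA divff// mul1r.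
  apply: measurable_funM; first exact: measurable_id.
  apply: (measurableT_comp (measurable_powR _)).
  by apply: measurable_funX; exact: measurable_id.
apply: measurable_funM; first exact: measurable_indic.
apply: measurable_funM.
  apply: measurableT_comp.
    by apply: continuous_measurable_fun; exact: sqrt_continuous.
  apply: measurable_maxr; last exact: measurable_cst.
  apply: measurable_funM; apply: measurable_funB;
    by [exact: measurable_id|exact: measurable_cst].
apply: (measurableT_comp minv).
by apply: measurable_funM; [exact: measurable_cst|exact: measurable_id].
Qed.

Let mp_line0 : mp_line set0 = 0%E.
Proof. by rewrite /mp_line integral_set0. Qed.

Let mp_line_ge0 A : (0 <= mp_line A)%E.
Proof. by apply: integral_ge0 => t _; rewrite lee_fin le_max lexx orbT. Qed.

Let mp_line_sigma_additive : semi_sigma_additive mp_line.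
Proof.
apply: (@semi_sigma_additive_nng_induced _ _ R lebesgue_measure
  (fun t => (Num.max (mp_density t) 0)%:E)) => [|t]; last first.
  by rewrite lee_fin le_max lexx orbT.
apply/measurable_EFinP/measurable_maxr; last exact: measurable_cst.
exact: measurable_mp_density.
Qed.

HB.instance Definition _ := isMeasure.Build _ _ _
  mp_line mp_line0 mp_line_ge0 mp_line_sigma_additive.

Let mp_measureE : mp_measure = pushforward mp_line real_axis.
Proof. by []. Qed.

Let mp_measure0 : mp_measure set0 = 0%E.
Proof. by rewrite mp_measureE /pushforward preimage_set0 measure0. Qed.

Let mp_measure_ge0 A : (0 <= mp_measure A)%E.
Proof. exact: mp_line_ge0. Qed.

Let mp_measure_sigma_additive : semi_sigma_additive mp_measure.
Proof.
move=> F mF tF mUF; rewrite /mp_measure /pushforward preimage_bigcup.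
have mpre B : measurable B -> measurable (@real_axis R @^-1` B).
  by move=> mB; rewrite -[X in measurable X]setTI; exact: measurable_real_axis.
apply: measure_semi_sigma_additive.
- by move=> n; exact: mpre.
- apply/trivIsetP => /= i j _ _ ij; rewrite -preimage_setI.
  by move/trivIsetP : tF => /(_ _ _ _ _ ij) ->//; rewrite preimage_set0.
- by rewrite -preimage_bigcup; exact: mpre.
Qed.

HB.instance Definition _ := isMeasure.Build _ _ _
  mp_measure mp_measure0 mp_measure_ge0 mp_measure_sigma_additive.

End marchenko_pastur.

Section dist.
Context {R : realType}.
Implicit Types (mu : {measure set (R * R) -> \bar R}) (z w : R * R).

(* Extended-real valued: lne maps 0 to -oo, so the potential is -oo at atoms. *)
Definition log_potential mu z : \bar R :=
  (\int[mu]_w lne (modulus (z - w))%:E)%E.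

Definition fs_density z : R := (pi * (1 + modulus z ^+ 2) ^+ 2)^-1.

(* The point at infinity is negligible for the Fubini-Study form, so the
   integral over the Riemann sphere is an integral over the plane. *)
Definition dist mu mu' : \bar R :=
  (\int[(@lebesgue_measure R \x @lebesgue_measure R)]_z
     (`|log_potential mu z - log_potential mu' z| * (fs_density z)%:E))%E.

End dist.

(* Functions of class C^gamma, gamma = k + theta with k a natural number and
   0 <= theta < 1: the derivatives up to order k exist and are continuous, and,
   when theta > 0, those of order k are theta-Hoelder. *)
Section hoelder_plane.
Context {R : realType}.
Implicit Types (f : R * R -> R) (D : set (R * R)).

Definition pd1 f : R * R -> R := fun z => 'D_(1, 0) f z.
Definition pd2 f : R * R -> R := fun z => 'D_(0, 1) f z.
Definition pd (i j : nat) f : R * R -> R := iter i pd1 (iter j pd2 f).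

Fixpoint class_Ck (k : nat) f : Prop :=
  continuous f /\
  if k is k'.+1 then
    [/\ forall z, derivable f z (1, 0), forall z, derivable f z (0, 1),
        class_Ck k' (pd1 f) & class_Ck k' (pd2 f)]
  else True.

Definition sup_norm D f : \bar R := ereal_sup [set `|f z|%:E | z in D].

Definition hoelder_seminorm D (theta : R) f : \bar R :=
  ereal_sup [set e | exists z w, [/\ D z, D w, z <> w &
    e = (`|f z - f w| / modulus (z - w) `^ theta)%:E]].

Definition hoelder_norm (gamma : R) D f : \bar R :=
  let k := Num.truncn gamma in
  let theta := gamma - k%:R in
  (\sum_(i < k.+1) \sum_(j < k.+1 | (i + j <= k)%N) sup_norm D (pd i j f) +
   (if theta == 0%R then 0
    else \sum_(i < k.+1) hoelder_seminorm D theta (pd i (k - i) f)))%E.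

End hoelder_plane.

(* The Riemann sphere is the one-point compactification of the plane (None is
   the point at infinity), with the two charts z and 1/z.  The C^gamma norm is
   computed in these charts over the discs of radius 2, whose union is the
   whole sphere. *)
Section hoelder_sphere.
Context {R : realType}.
Implicit Types varphi : one_point_compactification (R * R) -> R.

Definition chart0 varphi (z : R * R) : R := varphi (Some z).

Definition chart_oo varphi (w : R * R) : R :=
  varphi (if w == 0 then None else Some (plane_inv w)).

Definition sphere_norm (gamma : R) varphi : \bar R :=
  maxe (hoelder_norm gamma [set z | modulus z < 2] (chart0 varphi))
       (hoelder_norm gamma [set z | modulus z < 2] (chart_oo varphi)).

Definition sphere_class (gamma : R) varphi : Prop :=
  [/\ class_Ck (Num.truncn gamma) (chart0 varphi),
      class_Ck (Num.truncn gamma) (chart_oo varphi) &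
      (sphere_norm gamma varphi < +oo)%E].

Definition dist_gamma (gamma : R)
    (mu mu' : {measure set (R * R) -> \bar R}) : \bar R :=
  ereal_sup [set e | exists varphi,
    [/\ sphere_class gamma varphi, (sphere_norm gamma varphi <= 1)%E &
        e = `|\int[mu]_z (varphi (Some z))%:E -
              \int[mu']_z (varphi (Some z))%:E|%E]].

End hoelder_sphere.

(* Main.v *)
Require Import Defs.
From HB Require Import structures.
From mathcomp Require Import all_boot all_order all_algebra.
From mathcomp Require Import complex.
From mathcomp Require Import all_classical all_reals all_analysis.
From mathcomp Require Import polyrcf.
From mathcomp Require Import measurable_realfun.
From mathcomp Require Import ring lra.

(** Both measures live on the real axis, so the three estimates follow from one
    statement about distribution functions: on every half-line the two measures
    differ by at most [9 ln p / p] ([kolmogorov]).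

    That statement is a count of zeros by Pruefer angles. With [N = p + alpha]
    and [q] the rescaled polynomial, [y = t^(alpha/2) exp(- N t / 2) q] solves
    [(t d/dt)^2 y = - P y] with [P] quadratic, and [P - N t / 2] is exactly the
    square of [pi p t rho], where [rho] is the Marchenko-Pastur density.
    Parametrize the support by [t = 1 + r^2 - 2 r cos psi], [r = sqrt phi], and
    let [w] be the cotangent of the angle of [y]. Then
      [d (- atan w) / d psi = 2 p sin^2 psi / t + (1 + w cot psi) / (1 + w^2)].
    The first term is [pi p] times the density of the limit law in [psi]. The
    second one is at least [- |cot psi| / 2], whose integral over
    [1/p, pi - 1/p] has order [ln p]. On an arc without zeros [atan w] stays
    within a half turn, so that every arc contains at least as many zeros as the
    limit law predicts, up to a multiple of [ln p] ([phase_count_arc]). There are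
    exactly [p] zeros, all real, and the limit law has mass one, so that the lower
    bounds on complementary arcs give the upper bounds ([count_lt_ge],
    [count_le_le]). Reality comes from Rolle's theorem ([laguerre_factor]), the
    bound 6 for the zeros from the decay of [y] beyond the turning point
    ([rescaled_root_lt6]).

    Intervals are differences of half-lines. Integrals of a function [h] on the axis
    are compared by summation by parts over a grid ([compare_integrals]): the
    difference is at most twice the oscillation of [h] on a cell plus the
    Kolmogorov distance times the sum of the increments of [h]. For potentials,
    [h] is [ln |z - t|]; its total variation on [0, 6] is finite off the real axis
    and integrable for the Fubini-Study form ([dist_le_cdf]). For test functions of
    class [gamma], [h] is Hoelder of exponent [min (gamma, 1)], and a grid of [6 p]
    cells gives the rate [p^(- min (gamma, 1)) ln p], at least as good,
    up to a constant, as the required one ([dist_gamma_laguerre_mp]). *)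

Set Implicit Arguments.
Unset Strict Implicit.
Unset Printing Implicit Defensive.

Import Order.TTheory GRing.Theory Num.Theory.
Import numFieldNormedType.Exports.

Local Open Scope classical_set_scope.
Local Open Scope ring_scope.

(** * Laguerre polynomials *)

Section laguerre_algebra.
Context {R : realType}.
Implicit Types (alpha : R) (p : nat).

Lemma gbinomS (x : R) m :
  m.+1%:R * gbinom x m.+1 = (x - m%:R) * gbinom x m.
Proof.
have m0 : (m.+1%:R : R) != 0 by rewrite pnatr_eq0.
have f0 : (m`!%:R : R) != 0 by rewrite pnatr_eq0 -lt0n fact_gt0.
rewrite /gbinom big_ord_recr/= factS natrM.
by field; rewrite nat1r m0 f0.
Qed.

Lemma gbinom_gt0 (x : R) m : m%:R < x + 1 -> 0 < gbinom x m.
Proof.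
move=> mx; apply: divr_gt0; last by rewrite ltr0n fact_gt0.
apply: prodr_gt0 => i _; rewrite subr_gt0.
rewrite -(ltrD2r 1) natr1; apply: le_lt_trans mx.
by rewrite ler_nat.
Qed.

Lemma coef_laguerre p alpha k : (laguerre p alpha)`_k =
  if (k < p.+1)%N then gbinom (p%:R + alpha) (p - k) * (-1) ^+ k / (k`!)%:R
  else 0.
Proof. by rewrite /laguerre coef_poly. Qed.

Lemma coef_laguerre_rec p alpha k :
  (p%:R - k%:R) * (laguerre p alpha)`_k =
  - (k.+1%:R * (k.+1%:R + alpha) * (laguerre p alpha)`_k.+1).
Proof.
rewrite !coef_laguerre !ltnS.
have [pk|kp|->] := ltngtP p k; rewrite ?mulr0 ?oppr0//; last first.
  by rewrite subrr mul0r.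
have k0 : (k.+1%:R : R) != 0 by rewrite pnatr_eq0.
have f0 : (k`!%:R : R) != 0 by rewrite pnatr_eq0 -lt0n fact_gt0.
have := gbinomS (p%:R + alpha) (p - k.+1).
rewrite subnSK// -natrB; last exact: ltnW.
set g := gbinom _ _; set h := gbinom _ _ => gh.
have -> : (p - k)%:R * (g * (-1) ^+ k / k`!%:R) =
   ((p - k)%:R * g) * (-1) ^+ k / k`!%:R by ring.
rewrite gh natrB// factS natrM exprS.
by field; rewrite nat1r k0 f0.
Qed.

(** Comparing coefficients turns the differential equation into the two-term
    recurrence [coef_laguerre_rec]. *)
Lemma laguerre_ode p alpha :
  'X * (laguerre p alpha)^`()^`() +
  ((alpha + 1)%:P - 'X) * (laguerre p alpha)^`() +
  p%:R *: laguerre p alpha = 0.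
Proof.
apply/polyP => k.
rewrite coef0 !coefD mulrBl coefB coefCM !coefXM coefZ.
have := coef_laguerre_rec p alpha k.
case: k => [|k] /=.
  by rewrite !coef_deriv /= => H; lra.
move=> H; rewrite !coef_deriv -[_`_k.+2 *+ k.+2]mulr_natr -[_ * _ *+ k.+1]mulr_natr.
rewrite -[_`_k.+1 *+ k.+1]mulr_natr; move: H.
have -> : (k.+2%:R : R) = k.+1%:R + 1 by rewrite natr1.
move: (k.+1%:R) _`_k.+2 _`_k.+1 => c u v H.
have -> : p%:R * v = (p%:R - c) * v + c * v by ring.
by rewrite H; ring.
Qed.

(** This is the derivative of [x^(alpha+1) exp(-x) L_p^(alpha+1)] with the
    weight divided out. As [p + alpha] does not change, both sides involve the
    same generalized binomials. *)
Lemma laguerre_raise p alpha :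
  'X * (laguerre p (alpha + 1))^`() +
    ((alpha + 1)%:P - 'X) * laguerre p (alpha + 1) =
  p.+1%:R *: laguerre p.+1 alpha.
Proof.
apply/polyP => k.
rewrite !coefD mulrBl coefB coefCM !coefXM coefZ.
have e : p%:R + (alpha + 1) = p.+1%:R + alpha by rewrite -natr1; ring.
case: k => [|k] /=.
  rewrite !coef_laguerre /= e add0r subr0 expr0 fact0 !divr1 !mulr1 !subn0.
  by rewrite gbinomS -natr1; congr (_ * _); ring.
rewrite coef_deriv !coef_laguerre !ltnS e subSS.
have k0 : (k.+1%:R : R) != 0 by rewrite pnatr_eq0.
have f0 : (k`!%:R : R) != 0 by rewrite pnatr_eq0 -lt0n fact_gt0.
have [pk|kp|->] := ltngtP p k.
- by rewrite !mulr0 mul0rn subr0 addr0.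
- have := gbinomS (p.+1%:R + alpha) (p - k.+1).
  rewrite subnSK// !natrB; [|by []|exact: ltnW].
  set g := gbinom _ _; set h := gbinom _ _ => gh.
  rewrite factS natrM exprS -[_ / _ *+ k.+1]mulr_natr.
  have -> : p.+1%:R * (g * (-1 * (-1) ^+ k) / (k.+1%:R * k`!%:R)) =
     ((p%:R - k%:R) * g + k.+1%:R * g) * (-1 * (-1) ^+ k) / (k.+1%:R * k`!%:R).
    by rewrite -!natr1; ring.
  rewrite gh -!natr1; field.
  by rewrite natr1 f0.
- rewrite subnn mul0rn mulr0 add0r sub0r factS natrM exprS.
  by field; rewrite nat1r f0 k0.
Qed.

Lemma size_laguerre p alpha : size (laguerre p alpha) = p.+1.
Proof.
apply: size_poly_eq; rewrite subnn /gbinom big_ord0 fact0 divr1 mul1r.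
by rewrite mulf_neq0 ?signr_eq0// invr_eq0 pnatr_eq0 -lt0n fact_gt0.
Qed.

Lemma lead_coef_laguerre p alpha :
  lead_coef (laguerre p alpha) = (-1) ^+ p / p`!%:R.
Proof.
rewrite lead_coefE size_laguerre coef_laguerre ltnSn subnn /gbinom big_ord0.
by rewrite fact0 divr1 mul1r.
Qed.

Lemma laguerre_at0 p alpha : -1 < alpha -> 0 < (laguerre p alpha).[0].
Proof.
move=> a1; rewrite horner_coef0 coef_laguerre/= subn0 expr0 mulr1 fact0 divr1.
by apply: gbinom_gt0; rewrite -addrA ltrDl; lra.
Qed.

End laguerre_algebra.

(** * Laguerre zeros are real and positive *)

Section real_roots.
Context {R : realType}.
Implicit Types (f g : {poly R}) (s : seq R).

(** At a simple zero the derivative is the product of the differences to the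
    other zeros, and each larger zero contributes a sign. *)
Lemma sgn_deriv_root (c : R) s1 s2 x :
  sorted <%R (s1 ++ x :: s2) ->
  0 < (-1) ^+ size (s1 ++ x :: s2) * c ->
  0 < (-1) ^+ (size s1).+1 *
      (c *: \prod_(a <- s1 ++ x :: s2) ('X - a%:P))^`().[x].
Proof.
move=> + c0; rewrite (sorted_pairwise lt_trans) pairwise_cat/=.
move=> /and4P[/allrelP s12 _ xs2 _].
set h := c *: (\prod_(a <- s1) ('X - a%:P) * \prod_(a <- s2) ('X - a%:P)).
have -> : c *: \prod_(a <- s1 ++ x :: s2) ('X - a%:P) = ('X - x%:P) * h.
  by rewrite big_cat big_cons /= /h -!mul_polyC; ring.
rewrite derivM derivXsubC mul1r hornerD hornerM hornerXsubC subrr mul0r addr0.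
rewrite /h hornerZ hornerM !horner_prod.
have p1 : 0 < \prod_(a <- s1) ('X - a%:P).[x].
  rewrite big_seq; apply: prodr_gt0 => a as1.
  by rewrite hornerXsubC subr_gt0 s12// mem_head.
have p2 : 0 < (-1) ^+ size s2 * \prod_(a <- s2) ('X - a%:P).[x].
  elim: s2 xs2 {s12 c0 h} => [|a s IH] /=.
    by rewrite big_nil expr0 mulr1.
  move=> /andP[xa /IH s0]; rewrite big_cons exprS hornerXsubC.
  set e := (-1) ^+ _; set t := \prod_(_ <- _) _.
  rewrite (_ : _ * _ = (a - x) * (e * t)); last by rewrite /e /t; ring.
  by rewrite pmulr_rgt0 ?subr_gt0.
move: c0; rewrite size_cat/= addnS exprS exprD exprS => c0.
rewrite (_ : _ * (c * _) = (-1 * ((-1) ^+ size s1 * (-1) ^+ size s2) * c) *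
  (\prod_(a <- s1) ('X - a%:P).[x]) *
  ((-1) ^+ size s2 * \prod_(a <- s2) ('X - a%:P).[x])); last first.
  have : (-1) ^+ size s2 * (-1) ^+ size s2 = 1 :> R by rewrite -expr2 sqrr_sign.
  move: ((-1) ^+ size s2) => e ee.
  transitivity (-1 * (-1) ^+ size s1 * (c * (\prod_(a <- s1) ('X - a%:P).[x] *
   \prod_(a <- s2) ('X - a%:P).[x])) * (e * e)); first by rewrite ee mulr1.
  by ring.
by rewrite pmulr_rgt0// pmulr_rgt0.
Qed.

Lemma sign_changes_roots g s x n : path <%R x s ->
  0 < (-1) ^+ n * g.[x] ->
  (forall j, (j < size s)%N -> 0 < (-1) ^+ (n + j.+1) * g.[nth 0 s j]) ->
  exists rs : seq R, [/\ size rs = size s, path <%R x rs & all (root g) rs].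
Proof.
elim: s x n => [|y s IH] x n /=; first by exists [::].
move=> /andP[xy ys] gx gs.
have gy : 0 < (-1) ^+ n.+1 * g.[y] by have := gs 0%N isT; rewrite addn1.
have [|rs [rss yrs grs]] := IH y n.+1 ys gy.
  by move=> j js; have := gs j.+1 js; rewrite /= addSnnS.
have [|r + rg] := @poly_ivtoo _ g x y (ltW xy).
  rewrite -oppr_gt0; have := mulr_gt0 gx gy.
  rewrite exprS; set e := (-1) ^+ n.
  have -> : e * g.[x] * (-1 * e * g.[y]) = e ^+ 2 * - (g.[x] * g.[y]) by ring.
  by rewrite sqrr_sign mul1r.
rewrite in_itv/= => /andP[xr ry].
exists (r :: rs); split => /=; [by rewrite rss| |by rewrite rg].
by rewrite xr (path_le lt_trans ry).
Qed.

(** Rolle's theorem in disguise: at the zeros of [L_p^(alpha+1)] the identity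
    [laguerre_raise] reduces to its derivative term, whose signs alternate;
    the end points [0] and [+oo] provide two more sign changes. *)
Lemma laguerre_factor p (alpha : R) : -1 < alpha ->
  exists rs : seq R, [/\ size rs = p, path <%R 0 rs &
    laguerre p alpha = ((-1) ^+ p / p`!%:R) *: \prod_(r <- rs) ('X - r%:P)].
Proof.
elim: p alpha => [|p IH] alpha a1.
  exists [::]; split=> //; rewrite big_nil -(lead_coef_laguerre _ alpha).
  have /size1_polyC -> := eq_leq (size_laguerre 0 alpha).
  by rewrite lead_coefC alg_polyC.
have [|rs [srs prs Lrs]] := IH (alpha + 1); first lra.
set g := laguerre p.+1 alpha.
have gE x : p.+1%:R * g.[x] = x * (laguerre p (alpha + 1))^`().[x] +
    (alpha + 1 - x) * (laguerre p (alpha + 1)).[x].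
  have := congr1 (fun q => q.[x]) (laguerre_raise p alpha).
  by rewrite hornerZ -/g => <-; rewrite !hornerE.
have p0 : 0 < p.+1%:R :> R by rewrite ltr0n.
have [B Bg] : exists B, forall x, B <= x -> 0 < (-1) ^+ p.+1 * g.[x].
  have lg : 0 < lead_coef ((-1) ^+ p.+1 *: g).
    rewrite lead_coefZ lead_coef_laguerre mulrA -exprD addnn -signr_odd odd_double.
    by rewrite mul1r invr_gt0 ltr0n fact_gt0.
  have [B BE] := poly_pinfty_gt_lc lg; exists B => x /BE.
  by rewrite hornerZ; exact: lt_le_trans.
have rsp r : r \in rs -> 0 < r by move: r; apply/allP; exact: (order_path_min lt_trans).
have g0 : 0 < (-1) ^+ 0 * g.[0].
  by rewrite expr0 mul1r; exact: laguerre_at0.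
have Lroot r : r \in rs -> (laguerre p (alpha + 1)).[r] = 0.
  by move=> rrs; rewrite Lrs hornerZ (rootP _) ?mulr0// root_prod_XsubC.
pose C := Num.max B (last 0 rs + 1).
have [||ts [sts pts gts]] := @sign_changes_roots g (rcons rs C) 0 0 _ g0.
- rewrite rcons_path prs/= /C lt_max; apply/orP; right; lra.
- move=> j; rewrite size_rcons ltnS add0n nth_rcons leq_eqVlt.
  have [-> _|jr /= jrs] := eqVneq j (size rs).
    by rewrite ltnn srs; apply: Bg; rewrite /C le_max lexx.
  rewrite jrs; set r := nth 0 rs j.
  have rrs : r \in rs by exact: mem_nth.
  have E : rs = take j rs ++ r :: drop j.+1 rs by rewrite -drop_nth// cat_take_drop.
  rewrite -(pmulr_rgt0 _ p0) mulrCA gE Lroot// mulr0 addr0 mulrCA.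
  rewrite (pmulr_rgt0 _ (rsp _ rrs)).
  have := @sgn_deriv_root ((-1) ^+ p / p`!%:R) (take j rs) (drop j.+1 rs) r.
  rewrite -E -Lrs size_takel; last exact: ltnW.
  apply; first exact: path_sorted prs.
  rewrite srs mulrA -exprD addnn -signr_odd odd_double mul1r.
  by rewrite invr_gt0 ltr0n fact_gt0.
rewrite size_rcons srs in sts.
exists ts; split => //; rewrite -(lead_coef_laguerre _ alpha).
apply: all_roots_prod_XsubC => //; first by rewrite size_laguerre sts.
by rewrite uniq_rootsE (sorted_uniq lt_trans ltxx)// (path_sorted pts).
Qed.

End real_roots.

(** * The rescaled equation and the size of the zeros *)

Section calculus.
Context {R : realType}.

Lemma nondecreasing_is_derive (f df : R -> R) (a b : R) : a <= b ->
  (forall x, a <= x <= b -> is_derive x 1 f (df x)) ->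
  (forall x, a <= x <= b -> 0 <= df x) -> f a <= f b.
Proof.
move=> ab fdf df0; rewrite -subr_ge0.
have [||c] := @MVT_segment _ f df a b ab.
- by move=> x; rewrite in_itv/= => /andP[ax xb]; apply: fdf; rewrite !ltW.
- apply: derivable_within_continuous => x; rewrite in_itv/= => xab.
  by have := fdf _ xab => h; exact: ex_derive.
rewrite in_itv/= => cab ->; rewrite mulr_ge0 ?df0// subr_ge0//.
Qed.

End calculus.

Section rescaled.
Context {R : realType}.
Context (p : nat) (alpha : R) (alpha0 : 0 < alpha).
Let N : R := p%:R + alpha.
Let q := rescaled_laguerre p alpha.

Let N_gt0 : 0 < N. Proof. by rewrite ltr_wpDl. Qed.

Let qE x : q.[x] = (laguerre p alpha).[N * x].
Proof. by rewrite /q /rescaled_laguerre horner_comp hornerZ hornerX. Qed.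

Let q'E : q^`() = N *: ((laguerre p alpha)^`() \Po (N *: 'X)).
Proof. by rewrite /q /rescaled_laguerre deriv_comp derivZ derivX -scalerAr mulr1. Qed.

Lemma rescaled_ode x :
  x * q^`()^`().[x] + (alpha + 1 - N * x) * q^`().[x] + N * p%:R * q.[x] = 0.
Proof.
have := congr1 (fun P => N * P.[N * x]) (laguerre_ode p alpha).
rewrite horner0 mulr0 => <-.
rewrite !(hornerD, hornerM, hornerN, hornerZ, hornerX, hornerC) q'E
  derivZ deriv_comp derivZ derivX -scalerAr mulr1 qE.
by rewrite !hornerZ !horner_comp !hornerZ hornerX; ring.
Qed.

Lemma rescaled_factor : exists rs : seq R,
  [/\ size rs = p, path <%R 0 rs &
      q = lead_coef q *: \prod_(r <- rs) ('X - r%:P)].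
Proof.
have [|rs [srs prs Lrs]] := @laguerre_factor R p alpha; first by have := alpha0; lra.
have sN : size (N *: 'X : {poly R}) = 2.
  by rewrite size_scale ?size_polyX// lt0r_neq0.
have sq : size q = p.+1.
  by rewrite /q /rescaled_laguerre size_comp_poly2 ?size_laguerre.
exists [seq r / N | r <- rs]; split; first by rewrite size_map.
- rewrite -[X in path _ X](mul0r N^-1) (@path_map _ _ (fun r : R => r / N)).
  apply: sub_path prs => x y /= xy.
  by rewrite ltr_pM2r ?invr_gt0.
- apply: all_roots_prod_XsubC; first by rewrite sq size_map srs.
  + apply/allP => _ /mapP[r rrs ->]; rewrite /root qE mulrCA divff ?lt0r_neq0// mulr1.
    by rewrite Lrs hornerZ (rootP _) ?mulr0// root_prod_XsubC.
  + rewrite uniq_rootsE map_inj_uniq.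
      by rewrite (sorted_uniq lt_trans ltxx)// (path_sorted prs).
    by apply: mulIf; rewrite invr_eq0 lt0r_neq0.
Qed.

Lemma rescaled_neq0 : q != 0.
Proof.
rewrite -size_poly_gt0 /q /rescaled_laguerre size_comp_poly2 ?size_laguerre//.
by rewrite size_scale ?size_polyX// lt0r_neq0.
Qed.

(** For [y = t^(alpha/2) exp(- N t / 2) q], the logarithmic derivative
    [t y' / y] is the quotient of this polynomial by [q]; the Laguerre equation
    becomes [(t d/dt)^2 y = - P y], where [P] is [rescaled_freq]. *)
Definition rescaled_flow : {poly R} :=
  'X * q^`() + ((alpha / 2)%:P - (N / 2) *: 'X) * q.

Definition rescaled_freq (x : R) : R :=
  N * (p%:R + (alpha + 1) / 2) * x - N ^+ 2 * x ^+ 2 / 4 - alpha ^+ 2 / 4.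

Lemma rescaled_flowE x :
  rescaled_flow.[x] = x * q^`().[x] + (alpha - N * x) / 2 * q.[x].
Proof.
by rewrite /rescaled_flow !(hornerD,hornerM,hornerN,hornerZ,hornerX,hornerC); field.
Qed.

Lemma deriv_rescaled_flow x : x * rescaled_flow^`().[x] =
  - ((alpha - N * x) / 2 * rescaled_flow.[x]) - rescaled_freq x * q.[x].
Proof.
have H := rescaled_ode x.
rewrite rescaled_flowE /rescaled_flow derivD !derivM derivX derivB derivC.
rewrite derivZ derivX mul1r !(hornerD,hornerM,hornerN,hornerZ,hornerX,hornerC).
have {H} -> : x * q^`()^`().[x] =
   - ((alpha + 1 - N * x) * q^`().[x] + N * p%:R * q.[x]) by lra.
by rewrite /rescaled_freq; field.
Qed.

Lemma rescaled_flow_sign : exists B, forall x, B <= x ->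
  (q * rescaled_flow).[x] < 0.
Proof.
have q0 := rescaled_neq0.
have sX : size ((alpha / 2)%:P - (N / 2) *: 'X : {poly R}) = 2.
  have N2 : N / 2 != 0 by rewrite mulf_neq0 ?lt0r_neq0.
  have s2 : size (- (N / 2 *: 'X : {poly R})) = 2.
    by rewrite size_polyN size_scale// size_polyX.
  by rewrite addrC size_polyDl s2// (leq_ltn_trans (size_polyC_leq1 _)).
have lX : lead_coef ((alpha / 2)%:P - (N / 2) *: 'X : {poly R}) = - (N / 2).
  by rewrite lead_coefE sX coefB coefC coefZ coefX/= mulr1 sub0r.
have lk : lead_coef rescaled_flow = - (N / 2) * lead_coef q.
  rewrite /rescaled_flow lead_coefDr ?lead_coefM ?lX//.
  rewrite (@size_proper_mul _ _ q) ?sX ?lX; last first.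
    by rewrite mulf_neq0 ?lead_coef_eq0// oppr_eq0 mulf_neq0 ?lt0r_neq0.
  rewrite -size_poly_gt0 in q0.
  have [->|q'0] := eqVneq q^`() 0; first by rewrite mulr0 size_poly0.
  by rewrite mulrC size_mulX//= ltnS lt_size_deriv// -size_poly_gt0.
have lqk : 0 < lead_coef (- (q * rescaled_flow)).
  rewrite lead_coefN lead_coefM lk.
  have -> : - (lead_coef q * (- (N / 2) * lead_coef q)) =
     (N / 2) * lead_coef q ^+ 2 by ring.
  by rewrite mulr_gt0 ?divr_gt0// exprn_even_gt0//= lead_coef_eq0.
have [B BE] := poly_pinfty_gt_lc lqk; exists B => x /BE H.
by rewrite -oppr_gt0 -hornerN; exact: lt_le_trans H.
Qed.

(** From 6 on, [rescaled_freq] is nonpositive, so that [y * (t d/dt) y], for [y]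
    as in [rescaled_flow], is nondecreasing. It cannot vanish there, as it is
    negative near infinity. *)
Lemma rescaled_root_lt6 x : (0 < p)%N -> root q x -> x < 6.
Proof.
move=> p0 qx; rewrite ltNge; apply/negP => x6.
have [B HB] := rescaled_flow_sign.
pose M t := expR (alpha * ln t - N * t) * (q * rescaled_flow).[t].
have p1 : 1 <= p%:R :> R by rewrite ler1n.
suff : M x <= M (Num.max x B).
  rewrite /M hornerM (rootP qx) mul0r mulr0 leNgt.
  by rewrite nmulr_llt0 ?HB ?expR_gt0// le_max lexx orbT.
pose dM t := expR (alpha * ln t - N * t) / t *
  (rescaled_flow.[t] ^+ 2 - rescaled_freq t * q.[t] ^+ 2).
apply: (@nondecreasing_is_derive _ M dM); first by rewrite le_max lexx.
- move=> t /andP[xt _].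
  have t0 : 0 < t by lra.
  have := @is_derive_poly _ (q * rescaled_flow) t => dqk.
  have := @is_derive1_ln _ _ t0 => dln.
  have := deriv_rescaled_flow t; have := rescaled_flowE t.
  rewrite /M /dM; move: dqk; move: rescaled_flow => F dqk FE F'E.
  apply: is_derive_eq; rewrite derivM hornerD !hornerM !scaler1 /GRing.scale/=.
  have t1 : t != 0 by rewrite lt0r_neq0.
  have -> : q^`().[t] = (F.[t] - (alpha - N * t) / 2 * q.[t]) / t.
    by rewrite FE; field.
  have -> : F^`().[t] =
      (- ((alpha - N * t) / 2 * F.[t]) - rescaled_freq t * q.[t]) / t.
    by rewrite -F'E; field.
  by field.
- move=> t /andP[xt _].
  have t0 : 0 < t by lra.
  rewrite /dM mulr_ge0 ?divr_ge0 ?expR_ge0 ?(ltW t0)//.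
  rewrite subr_ge0 (@le_trans _ _ 0) ?sqr_ge0// mulr_le0_ge0 ?sqr_ge0//.
  apply: (@le_trans _ _ (N * t * (p%:R + (alpha + 1) / 2 - N * t / 4))).
    rewrite /rescaled_freq -subr_ge0 (_ : _ - _ = alpha ^+ 2 / 4); last by field.
    by rewrite divr_ge0 ?sqr_ge0.
  rewrite pmulr_rle0 ?mulr_gt0//.
  have : N * 6 <= N * t by rewrite ler_pM2l// (le_trans x6).
  have a0 := alpha0; rewrite /N; lra.
Qed.

End rescaled.

(** * Angular parametrization of the limit law *)

Section mp_parametrization.
Context {R : realType} (r : R) (r0 : 0 < r) (r1 : r < 1).

(** This is [|1 - r e^(i psi)|^2]; it runs through the support of the limit law
    as [psi] goes from 0 to [pi]. *)
Definition mp_path (psi : R) : R := 1 + r ^+ 2 - 2 * r * cos psi.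

(** The primitive of [sin^2 / mp_path] that vanishes at 0, that is, [pi / 2]
    times the distribution function of the limit law in the angular variable;
    the arctangent is minus the argument of [1 - r e^(i psi)]. *)
Definition mp_phase (psi : R) : R :=
  psi / 2 + sin psi / (2 * r) -
  (1 - r ^+ 2) / (2 * r ^+ 2) * atan (r * sin psi / (1 - r * cos psi)).

Let oneBrcos_gt0 psi : 0 < 1 - r * cos psi.
Proof.
rewrite subr_gt0; have c1 := cos_le1 psi.
by apply: le_lt_trans r1; rewrite ler_piMr// ltW.
Qed.

Lemma mp_pathE psi :
  mp_path psi = (1 - r * cos psi) ^+ 2 + (r * sin psi) ^+ 2.
Proof.
rewrite /mp_path [(r * sin _) ^+ 2]exprMn sin2cos2.
ring.
Qed.

Lemma mp_path_gt0 psi : 0 < mp_path psi.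
Proof. by rewrite mp_pathE ltr_pwDl ?exprn_gt0// sqr_ge0. Qed.

Lemma sin2_le_mp_path psi : sin psi ^+ 2 <= mp_path psi.
Proof.
rewrite -subr_ge0 (_ : _ - _ = (r - cos psi) ^+ 2) ?sqr_ge0//.
by rewrite /mp_path sin2cos2; ring.
Qed.

Lemma is_derive_mp_path (psi : R) : is_derive psi (1 : R) mp_path (2 * r * sin psi).
Proof. by rewrite /mp_path; apply: is_derive_eq; rewrite /GRing.scale/=; ring. Qed.

Lemma is_derive_mp_phase (psi : R) :
  is_derive psi (1 : R) mp_phase (sin psi ^+ 2 / mp_path psi).
Proof.
have u0 : 1 - r * cos psi != 0 by rewrite lt0r_neq0.
have z0 : mp_path psi != 0 by rewrite lt0r_neq0// mp_path_gt0.
have rn0 : r != 0 by rewrite lt0r_neq0.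
have zE := mp_pathE psi.
rewrite /mp_phase; apply: is_derive_eq; rewrite /GRing.scale/=.
have -> : (1 + (r * sin psi / (1 - r * cos psi)) ^+ 2)^-1 =
   (1 - r * cos psi) ^+ 2 / mp_path psi.
  by rewrite zE; field; rewrite -zE u0 z0.
have -> : psi * (- 2 ^- 2 * 0) + 2^-1 * 1 + (sin psi * 0 + (2 * r)^-1 * cos psi) -
  (1 - r ^+ 2) / (2 * r ^+ 2) *
  ((1 - r * cos psi) ^+ 2 / mp_path psi *
   (r * sin psi * (- (1 - r * cos psi) ^- 2 * ((0 + 1) * - (r * - sin psi))) +
    (1 - r * cos psi)^-1 * (r * cos psi))) =
  2^-1 + cos psi / (2 * r) - (1 - r ^+ 2) / (2 * r ^+ 2) *
  (r * cos psi * (1 - r * cos psi) - r ^+ 2 * sin psi ^+ 2) / mp_path psi.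
  by field; rewrite u0 z0 rn0.
rewrite sin2cos2; move: z0; rewrite /mp_path => z0.
by field; rewrite z0 rn0.
Qed.

Lemma mp_phase0 : mp_phase 0 = 0.
Proof. by rewrite /mp_phase sin0 !(mulr0, mul0r) atan0 mulr0 addr0 subr0. Qed.

Lemma mp_phasepi : mp_phase pi = pi / 2.
Proof. by rewrite /mp_phase sinpi !(mulr0, mul0r) atan0 mulr0 addr0 subr0. Qed.

Let dphase_ge0 psi : 0 <= sin psi ^+ 2 / mp_path psi.
Proof. by rewrite divr_ge0 ?sqr_ge0// ltW// mp_path_gt0. Qed.

Lemma mp_phase_le (x y : R) : x <= y -> mp_phase x <= mp_phase y.
Proof.
move=> xy; apply: (@nondecreasing_is_derive _ mp_phase
  (fun z => sin z ^+ 2 / mp_path z) _ _ xy) => z _; last exact: dphase_ge0.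
exact: is_derive_mp_phase.
Qed.

(** Since [sin^2 <= mp_path], the density is bounded in the angular variable,
    uniformly in [r]; this is what controls both ends of the spectrum. *)
Lemma mp_phase_lip (x y : R) : x <= y -> mp_phase y - mp_phase x <= y - x.
Proof.
move=> xy.
suff : x - mp_phase x <= y - mp_phase y by lra.
apply: (@nondecreasing_is_derive _ (fun z => z - mp_phase z)
  (fun z => 1 - sin z ^+ 2 / mp_path z) _ _ xy) => z _.
  by have := is_derive_mp_phase z => h; apply: is_derive_eq.
by rewrite subr_ge0 ler_pdivrMr ?mp_path_gt0// mul1r sin2_le_mp_path.
Qed.

Lemma mp_path_lt : {in `[0, pi] &, {mono mp_path : x y / x < y}}.
Proof.
move=> x y x0 y0; rewrite /mp_path ltrD2l ltrN2 ltr_pM2l ?mulr_gt0//.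
exact: ltr_cos.
Qed.

End mp_parametrization.

Section cotangent.
Context {R : realType}.
Implicit Types psi : R.

Lemma mul_cos_le_sin psi : 0 <= psi <= pi -> psi * cos psi <= sin psi.
Proof.
move=> /andP[p0 ppi]; rewrite -subr_ge0.
have := @nondecreasing_is_derive R (fun t => sin t - t * cos t)
  (fun t => t * sin t) 0 psi p0.
rewrite sin0 mul0r subr0; apply.
- by move=> x _; apply: is_derive_eq; rewrite /GRing.scale/=; ring.
- move=> x /andP[x0 xp]; rewrite mulr_ge0// sin_ge0_pi// x0/=.
  exact: le_trans ppi.
Qed.

(** The right-hand side has an elementary primitive, of logarithmic size at
    distance [1 / p] from the end points. *)
Lemma norm_cot_le psi : 0 < psi < pi ->
  `|cos psi / sin psi| <= psi^-1 + (pi - psi)^-1.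
Proof.
move=> /andP[p0 ppi].
have s0 : 0 < sin psi by rewrite sin_gt0_pi// p0.
have q0 : 0 < pi - psi by rewrite subr_gt0.
have h1 : psi * cos psi <= sin psi by rewrite mul_cos_le_sin// !ltW.
have h2 : - ((pi - psi) * cos psi) <= sin psi.
  have := @mul_cos_le_sin (pi - psi).
  rewrite cosB sinB cospi sinpi !mul0r !mulN1r sub0r addr0 opprK mulrN.
  by apply; rewrite !ltW// gtrBl.
have k1 : cos psi / sin psi <= psi^-1.
  by rewrite ler_pdivrMr// mulrC ler_pdivlMr// mulrC.
have k2 : - (cos psi / sin psi) <= (pi - psi)^-1.
  by rewrite -mulNr ler_pdivrMr// mulrC ler_pdivlMr// mulrC mulrN.
rewrite ler_norml; apply/andP; split.
  by rewrite lerNl (le_trans k2)// lerDr invr_ge0 ltW.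
by rewrite (le_trans k1)// lerDl invr_ge0 ltW.
Qed.

End cotangent.

(** * The Pruefer angle and the zeros on an arc *)

Section phase.
Context {R : realType} (p : nat) (alpha r : R).
Context (alpha0 : 0 < alpha) (r0 : 0 < r) (Nr2 : (p%:R + alpha) * r ^+ 2 = p%:R).
Let N : R := p%:R + alpha.
Let q := rescaled_laguerre p alpha.
Let z := mp_path r.

Let N_gt0 : 0 < N. Proof. by rewrite ltr_wpDl. Qed.

Let alphaE : alpha = N * (1 - r ^+ 2).
Proof. by rewrite mulrBr mulr1 [N * _]Nr2 /N addrAC subrr add0r. Qed.

Let r1 : r < 1.
Proof.
have : 0 < N * (1 - r ^+ 2) by rewrite -alphaE.
by rewrite pmulr_rgt0// subr_gt0 expr_lt1// ltW.
Qed.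

Let z_gt0 x : 0 < z x. Proof. exact: mp_path_gt0. Qed.

(** Up to the last term, whose contribution to the phase has the favourable
    sign, the frequency of the equation is the one of the limit law. *)
Let freqE x : rescaled_freq p alpha (z x) = (N * r * sin x) ^+ 2 + N * z x / 2.
Proof.
rewrite /rescaled_freq -/N.
have -> : p%:R = N * r ^+ 2 by [].
rewrite {1 2}alphaE.
have -> : (N * r * sin x) ^+ 2 = (N * r) ^+ 2 * (1 - cos x ^+ 2).
  by rewrite exprMn sin2cos2.
by rewrite /z /mp_path; field.
Qed.

(** With [y] as in [rescaled_flow], this is [t y' / (s y)] at [t = z x], where
    [s = N r sin x] is the frequency of the limit law: the cotangent of a
    Pruefer angle. *)
Definition flow_slope x : R :=
  (rescaled_flow p alpha).[z x] / (N * r * sin x * q.[z x]).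

(** A primitive of half the bound in [norm_cot_le]. *)
Definition slack x : R := (ln x - ln (pi - x)) / 2.

Lemma is_derive_slack (x : R) : 0 < x < pi ->
  is_derive x (1 : R) slack ((x^-1 + (pi - x)^-1) / 2).
Proof.
move=> /andP[x0 xpi]; have y0 : 0 < pi - x by rewrite subr_gt0.
rewrite /slack.
have d1 := @is_derive1_ln _ _ x0.
have d2 : is_derive x (1 : R) (fun t => ln (pi - t)) (- (pi - x)^-1).
  have := @is_derive1_ln _ _ y0 => h.
  by apply: is_derive_eq; rewrite /GRing.scale/=; ring.
by apply: is_derive_eq; rewrite /GRing.scale/=; ring.
Qed.

(** The Pruefer equation as an identity between numbers: [K] and [Q] are the
    values of the flow and of [q] at [Z], and [K'] and [Q'] are their derivatives,
    eliminated by means of the differential equation. *)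
Lemma slope_algebra (K Q Z s c u : R) : Z != 0 -> s != 0 -> Q != 0 ->
  let w := K / (N * r * s * Q) in
  let K' := (- (u * K) - ((N * r * s) ^+ 2 + N * Z / 2) * Q) / Z in
  let Q' := (K - u * Q) / Z in
  - ((1 + w ^+ 2)^-1 * ((K' * (2 * r * s) * (N * r * s * Q) -
     K * (N * r * c * Q + N * r * s * (Q' * (2 * r * s)))) /
     (N * r * s * Q) ^+ 2)) =
  2 * (N * r ^+ 2) * (s ^+ 2 / Z) + (1 + c / s * w) / (1 + w ^+ 2).
Proof.
move=> Z0 s0 Q0 w K' Q'.
have N0 : N != 0 by rewrite lt0r_neq0.
have rn0 : r != 0 by rewrite lt0r_neq0.
have W0 : 1 + w ^+ 2 != 0 by rewrite lt0r_neq0// ltr_pwDl// sqr_ge0.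
have D0 : N * r * s * Q != 0 by rewrite !mulf_neq0.
have -> : K = w * (N * r * s * Q) by rewrite /w divfK.
rewrite /K' /Q'.
have -> : K = w * (N * r * s * Q) by rewrite /w divfK.
clearbody w; field.
by rewrite W0 Z0 s0 N0 rn0 Q0.
Qed.

Lemma is_derive_slope (x : R) : 0 < x < pi -> ~~ root q (z x) ->
  is_derive x (1 : R) (fun t => - atan (flow_slope t))
    (2 * p%:R * (sin x ^+ 2 / z x) +
     (1 + cos x / sin x * flow_slope x) / (1 + flow_slope x ^+ 2)).
Proof.
move=> xpi qx.
have s0 : sin x != 0 by rewrite lt0r_neq0// sin_gt0_pi.
have Z0 : z x != 0 by rewrite lt0r_neq0.
have D0 : N * r * sin x * q.[z x] != 0 by rewrite !mulf_neq0// lt0r_neq0.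
have dz := is_derive_mp_path r x.
have dk : is_derive x (1 : R) (fun t => (rescaled_flow p alpha).[z t])
    ((rescaled_flow p alpha)^`().[z x] * (2 * r * sin x)).
  exact: (@is_derive1_comp _ (horner (rescaled_flow p alpha)) z).
have dq : is_derive x (1 : R) (fun t => q.[z t])
    (q^`().[z x] * (2 * r * sin x)).
  exact: (@is_derive1_comp _ (horner q) z).
rewrite /flow_slope; apply: is_derive_eq; rewrite /GRing.scale/=.
have kE := rescaled_flowE p alpha (z x).
have k'E := deriv_rescaled_flow p alpha (z x).
rewrite freqE -/q -/N in k'E; rewrite -/q -/N in kE.
have e1 : q^`().[z x] =
    ((rescaled_flow p alpha).[z x] - (alpha - N * z x) / 2 * q.[z x]) / z x.
  by rewrite kE; field.
have e2 : (rescaled_flow p alpha)^`().[z x] =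
    (- ((alpha - N * z x) / 2 * (rescaled_flow p alpha).[z x]) -
     ((N * r * sin x) ^+ 2 + N * z x / 2) * q.[z x]) / z x.
  by rewrite -k'E; field.
have := @slope_algebra (rescaled_flow p alpha).[z x] q.[z x] (z x) (sin x)
  (cos x) ((alpha - N * z x) / 2) Z0 s0 qx.
rewrite /= -e1 -e2 [N * r ^+ 2]Nr2 => <-.
congr (- (_ * _)).
by set D := N * r * sin x * q.[z x] in D0 *; field.
Qed.

(** The error term of the Pruefer equation is bounded below because
    [2 |w| <= 1 + w ^ 2]. *)
Lemma cot_slope_ge (t e w : R) : `|t| <= e ->
  0 <= (1 + t * w) / (1 + w ^+ 2) + e / 2.
Proof.
move=> te; have W0 : 0 < 1 + w ^+ 2 by rewrite ltr_pwDl// sqr_ge0.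
have -> : (1 + t * w) / (1 + w ^+ 2) + e / 2 =
  (1 + t * w + e / 2 * (1 + w ^+ 2)) / (1 + w ^+ 2) by field; rewrite lt0r_neq0.
rewrite divr_ge0 ?(ltW W0)//.
have : - (t * w) <= e * `|w|.
  by rewrite (le_trans (ler_norm _))// normrN normrM ler_wpM2r.
have : 0 <= (e / 2) * (1 - `|w|) ^+ 2.
  by rewrite mulr_ge0 ?sqr_ge0// divr_ge0// (le_trans _ te).
have ww : `|w| ^+ 2 = w ^+ 2 by rewrite -normrX ger0_norm ?sqr_ge0.
have -> : e / 2 * (1 - `|w|) ^+ 2 = e / 2 * (1 + `|w| ^+ 2) - e * `|w| by field.
rewrite ww; lra.
Qed.

(** On arcs without zeros the Pruefer angle grows at least as fast as this. *)
Definition phase_count x : R := 2 * p%:R * mp_phase r x - slack x.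

(** Without zeros the slope is finite, and its arctangent stays within a half
    turn. *)
Lemma phase_count_free (x y : R) : 0 < x -> x <= y -> y < pi ->
  (forall t, x <= t <= y -> ~~ root q (z t)) ->
  phase_count y - phase_count x <= pi.
Proof.
move=> x0 xy ypi qxy.
have tpi t : x <= t <= y -> 0 < t < pi.
  by move=> /andP[xt ty]; rewrite (lt_le_trans x0 xt) (le_lt_trans ty ypi).
suff : - atan (flow_slope x) - phase_count x <= - atan (flow_slope y) - phase_count y.
  have := atan_ltpi2 (flow_slope x); have := atan_gtNpi2 (flow_slope y); lra.
apply: (@nondecreasing_is_derive _ (fun t => - atan (flow_slope t) - phase_count t)
  (fun t => (1 + cos t / sin t * flow_slope t) / (1 + flow_slope t ^+ 2) +
     (t^-1 + (pi - t)^-1) / 2) x y xy).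
- move=> t txy; have tp := tpi _ txy.
  have d1 := is_derive_slope tp (qxy _ txy).
  have d2 := is_derive_slack tp.
  have d3 := is_derive_mp_phase r0 r1 t.
  rewrite /phase_count; apply: is_derive_eq; rewrite /GRing.scale/= -/z.
  by ring.
- by move=> t /tpi tp; apply/cot_slope_ge/norm_cot_le.
Qed.

Lemma derivable_phase_count (x : R) : 0 < x < pi -> derivable phase_count x 1.
Proof.
move=> xpi; have d2 := is_derive_slack xpi.
have d3 := is_derive_mp_phase r0 r1 x.
by rewrite /phase_count; exact: ex_derive.
Qed.

Lemma phase_count_gap (x y : R) : 0 < x -> x < y -> y < pi ->
  (forall t, x < t < y -> ~~ root q (z t)) ->
  phase_count y - phase_count x <= pi.
Proof.
move=> x0 xy ypi qxy.
have cont t : 0 < t < pi -> {for t, continuous phase_count}.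
  move=> /derivable_phase_count d.
  by apply: differentiable_continuous; apply/derivable1_diffP.
have step u : x < u < y -> phase_count y - phase_count u <= pi.
  move=> /andP[xu uy]; rewrite lerBlDr.
  have /(@cvg_at_left_filter _ _ _ y) cy : {for y, continuous phase_count}.
    by apply: cont; rewrite (lt_trans x0 xy).
  apply: (cvgr_to_le cy); near=> v; rewrite -lerBlDr.
  have uv : u < v by near: v; exact: nbhs_left_gt.
  have vy : v < y by near: v; exact: nbhs_left_lt.
  apply: phase_count_free; [exact: lt_trans xu|exact: ltW|exact: lt_trans ypi|].
  move=> t /andP[ut tv]; apply: qxy.
  by rewrite (lt_le_trans xu ut) (le_lt_trans tv vy).
have /(@cvg_at_right_filter _ _ _ x) cx : {for x, continuous phase_count}.
  by apply: cont; rewrite x0 (lt_trans xy).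
rewrite lerBlDl -lerBlDr.
apply: (cvgr_to_ge cx); near=> u; rewrite lerBlDr -lerBlDl.
apply: step; apply/andP; split; near: u;
  [exact: nbhs_right_gt|exact: nbhs_right_lt].
Unshelve. all: by end_near. Qed.

(** Cutting the arc at its zeros leaves one more piece than there are zeros,
    each of them within a half turn. *)
Lemma phase_count_arc (rs : seq R) (x y : R) : 0 < x -> x < y -> y < pi ->
  (forall s, root q s -> s \in rs) ->
  phase_count y - phase_count x <=
    pi * (count (fun s => z x < s < z y) rs).+1%:R.
Proof.
move=> + + + qrs.
have [n] := ubnP (count (fun s => z x < s < z y) rs).
elim: n x y => // n IH x y; rewrite ltnS => cn x0 xy ypi.
have zlt u v : 0 <= u <= pi -> 0 <= v <= pi -> (z u < z v) = (u < v).
  by move=> hu hv; rewrite /z mp_path_lt.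
have xin : 0 <= x <= pi by rewrite (ltW x0) ltW// (lt_trans xy).
have yin : 0 <= y <= pi by rewrite (ltW ypi) ltW// (lt_trans x0).
have [/hasP[s srs /andP[xs sy]]|/hasPn nos] :=
    boolP (has (fun s => z x < s < z y) rs); last first.
  have -> : count (fun s => z x < s < z y) rs = 0%N.
    by apply/eqP; rewrite -leqn0 leqNgt -has_count; apply/hasPn.
  rewrite mulr1; apply: phase_count_gap => // t /andP[xt ty].
  apply/negP => /qrs /nos /negP; apply.
  have tin : 0 <= t <= pi.
    by rewrite (ltW (lt_trans x0 xt)) (ltW (lt_trans ty ypi)).
  by rewrite !zlt// xt ty.
have [c] : exists2 c, c \in `[x, y] & z c = s.
  apply: IVT; [exact: ltW| |].
    apply: derivable_within_continuous => t _.
    by have := is_derive_mp_path r t => h; exact: ex_derive.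
  by rewrite ge_min le_max (ltW xs) (ltW sy) orbT.
rewrite in_itv/= => /andP[xc cy] zc.
have cin : 0 <= c <= pi by rewrite (le_trans (ltW x0) xc) (le_trans cy (ltW ypi)).
have {}xc : x < c by rewrite -zlt// zc.
have {}cy : c < y by rewrite -zlt// zc.
(* Both halves lose the zero [s] at which the arc is cut. *)
have cs : (count (fun s => (z x < s < z c)%R) rs + count (fun s => (z c < s < z y)%R) rs
    < count (fun s => (z x < s < z y)%R) rs)%N.
  rewrite -count_predUI addnC (@eq_count _ (predI _ _) pred0); last first.
    move=> t /=; apply/negP => /andP[/andP[_ tc] /andP[ct _]].
    by have := lt_trans ct tc; rewrite ltxx.
  rewrite count_pred0 add0n.
  have : (count (predU (predU (fun s => (z x < s < z c)%R) (fun s => (z c < s < z y)%R))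
       (pred1 s)) rs <= count (fun s => (z x < s < z y)%R) rs)%N.
    apply: sub_count => t /= /orP[/orP[|]|/eqP ->].
    - by move=> /andP[-> tc]; rewrite (lt_trans tc)// zlt.
    - by move=> /andP[ct ->]; rewrite (lt_trans _ ct)// zlt.
    - by rewrite xs sy.
  apply: leq_trans.
  rewrite -[X in (X <= _)%N]addn1 -[X in (_ <= X)%N]addn0.
  rewrite -[in X in (_ <= X)%N](count_pred0 rs).
  rewrite -(@eq_count _ (predI (predU (fun s => (z x < s < z c)%R) (fun s => (z c < s < z y)%R))
     (pred1 s)) pred0); last first.
    move=> t /=; apply/negbTE/negP => /andP[+ /eqP ts]; rewrite ts.
    by rewrite zc !ltxx andbF.
  by rewrite count_predUI leq_add2l -has_count has_pred1.
have := IH x c _ x0 xc (lt_trans cy ypi).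
have := IH c y _ (lt_trans x0 xc) cy ypi.
move=> /(_ (leq_ltn_trans (leq_addl _ _) (leq_trans cs cn))) h1.
move=> /(_ (leq_ltn_trans (leq_addr _ _) (leq_trans cs cn))) h2.
have : pi * (count (fun s => z x < s < z c) rs + count (fun s => z c < s < z y) rs).+1%:R <=
   pi * (count (fun s => z x < s < z y) rs)%:R :> R.
  by rewrite ler_pM2l ?pi_gt0// ler_nat.
move: h1 h2; rewrite -!natr1 natrD !mulrDr; lra.
Qed.

End phase.

(** * Counting the zeros below a point *)

Section log_facts.
Context {R : realType}.

Lemma ln2_ge_half : 2^-1 <= ln 2 :> R.
Proof.
have := @le_ln1Dx R (- 2^-1).
have -> : 1 + - 2^-1 = 2^-1 :> R by field.
rewrite lnV ?posrE// lerN2; apply.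
by rewrite ltrN2 invf_lt1// ltr1n.
Qed.

Lemma ln_nat_ge_half p : (2 <= p)%N -> 2^-1 <= ln p%:R :> R.
Proof.
move=> p2; apply: (le_trans ln2_ge_half); rewrite ler_ln ?posrE ?ler_nat//.
by rewrite ltr0n; case: p p2.
Qed.

Lemma pi_lt4 : pi < 4 :> R.
Proof. have := @pihalf_lt2 R; lra. Qed.

End log_facts.

Section mp_angle.
Context {R : realType} (r : R) (r0 : 0 < r) (r1 : r < 1).

(** The clamping makes the distribution function constant outside the support. *)
Definition mp_angle (t : R) : R :=
  acos (Num.max (-1) (Num.min 1 ((1 + r ^+ 2 - t) / (2 * r)))).

Let clamp_in (u : R) : -1 <= Num.max (-1) (Num.min 1 u) <= 1.
Proof. by rewrite le_max lexx/= ge_max ge_min lexx andbT; lra. Qed.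

Lemma mp_angle_ge0 t : 0 <= mp_angle t.
Proof. exact: acos_ge0. Qed.

Lemma mp_angle_lepi t : mp_angle t <= pi.
Proof. exact: acos_lepi. Qed.

Let cos_angle t :
  cos (mp_angle t) = Num.max (-1) (Num.min 1 ((1 + r ^+ 2 - t) / (2 * r))).
Proof. by rewrite /mp_angle acosK// in_itv/=. Qed.

Let path_le x y : 0 <= x <= pi -> 0 <= y <= pi -> x <= y ->
  mp_path r x <= mp_path r y.
Proof.
move=> xp yp; rewrite le_eqVlt => /predU1P[->//|xy].
by rewrite ltW// mp_path_lt.
Qed.

Lemma mp_path_angle_le x t : 0 < x -> x <= mp_angle t -> mp_path r x <= t.
Proof.
move=> x0 xt.
have a0 := mp_angle_ge0 t; have api := mp_angle_lepi t.
apply: (@le_trans _ _ (mp_path r (mp_angle t))).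
  by apply: path_le; rewrite ?(ltW x0) ?(le_trans xt) ?a0.
have angle_gt0 := lt_le_trans x0 xt.
have : cos (mp_angle t) < 1.
  by rewrite -cos0 ltr_cos// in_itv/= ?lexx ?pi_ge0// a0.
rewrite /mp_path cos_angle; set u := _ / _ => c1.
have u1 : u < 1.
  rewrite ltNge; apply/negP => u1.
  by move: c1; rewrite (min_idPl u1) (max_idPr _) ?ltxx// lerN10.
have : u <= Num.max (-1) (Num.min 1 u) by rewrite le_max (min_idPr (ltW u1)) lexx orbT.
rewrite {1}/u ler_pdivrMr ?mulr_gt0//; lra.
Qed.

Lemma le_mp_path_angle x t : x < pi -> mp_angle t <= x -> t <= mp_path r x.
Proof.
move=> xpi tx.
have a0 := mp_angle_ge0 t; have api := mp_angle_lepi t.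
apply: (@le_trans _ _ (mp_path r (mp_angle t))); last first.
  by apply: path_le; rewrite ?a0 ?(ltW xpi) ?(le_trans a0).
have angle_ltpi := le_lt_trans tx xpi.
have : -1 < cos (mp_angle t).
  by rewrite -cospi ltr_cos// in_itv/= ?lexx ?pi_ge0// a0.
rewrite /mp_path cos_angle; set u := _ / _ => c1.
have u1 : -1 < u.
  by move: c1; rewrite lt_max ltxx/= lt_min => /andP[].
have : Num.max (-1) (Num.min 1 u) <= u.
  by rewrite ge_max (ltW u1) ge_min lexx orbT.
rewrite {2}/u ler_pdivlMr ?mulr_gt0//; lra.
Qed.

Definition mp_cdf (t : R) : R := 2 / pi * mp_phase r (mp_angle t).

End mp_angle.

Section counting.
Context {R : realType} (p : nat) (alpha r : R).
Context (alpha0 : 0 < alpha) (r0 : 0 < r) (Nr2 : (p%:R + alpha) * r ^+ 2 = p%:R).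
Context (p2 : (2 <= p)%N) (rs : seq R) (srs : size rs = p).
Context (qrs : forall s, root (rescaled_laguerre p alpha) s -> s \in rs).

Let r1 : r < 1.
Proof.
have p0 : 0 < p%:R :> R by rewrite ltr0n; case: p p2.
rewrite -(@expr_lt1 _ 2)// ?ltW//.
rewrite -(ltr_pM2l (_ : 0 < p%:R + alpha)) ?ltr_wpDl// Nr2 mulr1.
by rewrite ltrDl.
Qed.

Let p_gt0 : 0 < p%:R :> R. Proof. by rewrite ltr0n; case: p p2. Qed.
Let lnp : 2^-1 <= ln p%:R :> R := ln_nat_ge_half p2.
Let e : R := p%:R^-1.
Let e_gt0 : 0 < e. Proof. by rewrite invr_gt0. Qed.
Let e_le : e <= 2^-1.
Proof. by rewrite lef_pV2 ?posrE// ler_nat. Qed.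
Let pe : p%:R * e = 1. Proof. by rewrite /e divff// lt0r_neq0. Qed.
Let pi2 := @pi_ge2 R.
Let pi4 := @pi_lt4 R.

Let slack_le (t : R) : e <= t <= pi - e -> `|slack t| <= 3 / 2 * ln p%:R.
Proof.
move=> /andP[et te].
have aux (u : R) : e <= u <= pi - e -> - ln p%:R <= ln u <= 2 * ln p%:R.
  move=> /andP[eu ue]; have u0 := lt_le_trans e_gt0 eu.
  rewrite -lnV ?posrE// ler_ln ?posrE// eu/=.
  apply: (@le_trans _ _ (ln 4)).
    rewrite ler_ln ?posrE//; have := e_gt0; have := pi4; lra.
  rewrite -[4](_ : 2 ^+ 2 = 4 :> R); last by rewrite -natrX.
  by rewrite lnXn// -[_ *+ 2]mulr_natl ler_pM2l// ler_ln ?posrE// ler_nat.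
have := aux t; rewrite et te => /(_ isT) /andP[h1 h2].
have /aux/andP[h3 h4] : e <= pi - t <= pi - e by apply/andP; split; lra.
by rewrite ler_norml /slack; apply/andP; split; lra.
Qed.

(** The cut-off [1 / p] keeps the slack of order [ln p]; the two removed arcs carry
    a bounded number of zeros in the limit law, by [mp_phase_lip]. *)
Let arc_lower (x y : R) : e <= x -> y <= pi - e ->
  2 * p%:R / pi * (mp_phase r y - mp_phase r x) <=
  (count (fun s => mp_path r x < s < mp_path r y) rs)%:R + 5 * ln p%:R.
Proof.
move=> ex ye.
have [yx|xy] := leP y x.
  apply: (@le_trans _ _ 0); last first.
    by rewrite addr_ge0 ?ler0n// mulr_ge0//; have := lnp; lra.
  by rewrite mulr_ge0_le0 ?divr_ge0 ?mulr_ge0 ?pi_ge0// subr_le0 mp_phase_le.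
have x0 : 0 < x := lt_le_trans e_gt0 ex.
have ypi : y < pi by have := e_gt0; lra.
have := phase_count_arc alpha0 r0 Nr2 x0 xy ypi qrs.
rewrite /phase_count; set c := count _ _.
have := @slack_le x; rewrite ex (le_trans (ltW xy) ye) => /(_ isT).
have := @slack_le y; rewrite ye (le_trans ex (ltW xy)) => /(_ isT).
rewrite !ler_norml => /andP[h1 h2] /andP[h3 h4] h5.
rewrite mulrAC ler_pdivrMr ?pi_gt0//.
move: h5; rewrite -natr1.
have : ln p%:R * 2 <= ln p%:R * pi :> R by rewrite ler_wpM2l//; have := lnp; lra.
have : 2^-1 * pi <= ln p%:R * pi :> R by rewrite ler_wpM2r// pi_ge0.
lra.
Qed.

Let phase_e : mp_phase r e <= e.
Proof. by have := mp_phase_lip r0 r1 (ltW e_gt0); rewrite mp_phase0 !subr0. Qed.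

Let scale_e : 2 * p%:R / pi * e <= 1.
Proof. by rewrite mulrAC ler_pdivrMr ?pi_gt0// mul1r -mulrA pe mulr1. Qed.

Lemma count_lt_ge (t : R) :
  p%:R * mp_cdf r t - 9 * ln p%:R <= (count (fun s => s < t) rs)%:R.
Proof.
rewrite /mp_cdf; set psi := mp_angle r t.
have psi0 : 0 <= psi := mp_angle_ge0 r t.
have psipi : psi <= pi := mp_angle_lepi r t.
have K0 : 0 <= 2 * p%:R / pi :> R by rewrite divr_ge0 ?mulr_ge0 ?pi_ge0.
rewrite (_ : _ * (_ * mp_phase r psi) = 2 * p%:R / pi * mp_phase r psi); last by ring.
have [psie|epsi] := leP psi e.
  have := mp_phase_le r0 r1 psie; have := phase_e => h1 h2.
  have : 2 * p%:R / pi * mp_phase r psi <= 2 * p%:R / pi * e.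
    by rewrite ler_wpM2l// (le_trans h2).
  have := scale_e; have := lnp; have := ler0n R (count (fun s => s < t) rs); lra.
pose y := Num.min psi (pi - e).
have ye : y <= pi - e by rewrite /y ge_min lexx orbT.
have := arc_lower (lexx e) ye.
have : (count (fun s => mp_path r e < s < mp_path r y) rs)%:R <=
    (count (fun s => s < t) rs)%:R :> R.
  rewrite ler_nat; apply: sub_count => s /= /andP[_ sy].
  apply: (lt_le_trans sy); apply: mp_path_angle_le => //.
    by rewrite /y lt_min (lt_trans e_gt0 epsi)/=; have := pi2; have := e_le; lra.
  by rewrite /y ge_min lexx.
have hy : mp_phase r psi - mp_phase r y <= e.
  rewrite /y; have [h|h] := leP psi (pi - e); first by rewrite subrr ltW.
  by rewrite (le_trans (mp_phase_lip r0 r1 (ltW h)))//; lra.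
have : 2 * p%:R / pi * (mp_phase r psi - 2 * e) <=
       2 * p%:R / pi * (mp_phase r y - mp_phase r e).
  by rewrite ler_wpM2l//; have := phase_e; lra.
by have := scale_e; have := lnp; lra.
Qed.

(** There are [p] zeros in all, so that the lower bound for the number of zeros
    above [t] is an upper bound for those below. *)
Lemma count_le_le (t : R) :
  (count (fun s => s <= t) rs)%:R <= p%:R * mp_cdf r t + 9 * ln p%:R.
Proof.
have -> : (count (fun s => s <= t) rs)%:R =
    p%:R - (count (fun s => t < s) rs)%:R :> R.
  rewrite -{1}srs -(count_predC (fun s => s <= t) rs) natrD.
  rewrite (@eq_count _ (predC _) (fun s => t < s)) ?addrK// => s /=.
  by rewrite ltNge.
rewrite /mp_cdf; set psi := mp_angle r t.
have psi0 : 0 <= psi := mp_angle_ge0 r t.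
have psipi : psi <= pi := mp_angle_lepi r t.
have K0 : 0 <= 2 * p%:R / pi :> R by rewrite divr_ge0 ?mulr_ge0 ?pi_ge0.
rewrite (_ : _ * (_ * mp_phase r psi) = 2 * p%:R / pi * mp_phase r psi); last by ring.
have Kpi : 2 * p%:R / pi * (pi / 2) = p%:R :> R.
  by rewrite mulrA divfK ?gt_eqF ?pi_gt0// mulrAC divff ?mul1r.
have Hpi : mp_phase r (pi - e) >= pi / 2 - e.
  rewrite -(mp_phasepi r); have := @mp_phase_lip _ _ r0 r1 (pi - e) pi.
  by have := e_gt0; lra.
have [psie|epsi] := leP (pi - e) psi.
  have : 2 * p%:R / pi * (pi / 2 - e) <= 2 * p%:R / pi * mp_phase r psi.
    by rewrite ler_wpM2l// (le_trans Hpi)// mp_phase_le.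
  have := scale_e; have := lnp; have := ler0n R (count (fun s => t < s) rs); lra.
pose x := Num.max psi e.
have ex : e <= x by rewrite /x le_max lexx orbT.
have := arc_lower ex (lexx (pi - e)).
have : (count (fun s => mp_path r x < s < mp_path r (pi - e)) rs)%:R <=
    (count (fun s => t < s) rs)%:R :> R.
  rewrite ler_nat; apply: sub_count => s /= /andP[xs _].
  apply: le_lt_trans xs; apply: le_mp_path_angle => //.
    by rewrite /x gt_max (lt_trans epsi)/=; have := pi2; have := e_le; have := e_gt0; lra.
  by rewrite /x le_max lexx.
have hx : mp_phase r x - mp_phase r psi <= e.
  rewrite /x; have [h|h] := leP e psi; first by rewrite subrr ltW.
  by rewrite (le_trans (mp_phase_lip r0 r1 (ltW h)))//; lra.
have : 2 * p%:R / pi * (pi / 2 - 2 * e - mp_phase r psi) <=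
       2 * p%:R / pi * (mp_phase r (pi - e) - mp_phase r x).
  by rewrite ler_wpM2l//; lra.
by have := scale_e; have := lnp; lra.
Qed.

End counting.

(** * The distribution function of the Marchenko-Pastur law *)

Section mp_distribution.
Context {R : realType} (r : R) (r0 : 0 < r) (r1 : r < 1).
Let mu := @lebesgue_measure R.

Let sqrt_phi : Num.sqrt (r ^+ 2) = r.
Proof. by rewrite sqrtr_sqr gtr0_norm. Qed.

Let leftE : mp_left (r ^+ 2) = mp_path r 0.
Proof. by rewrite /mp_left sqrt_phi /mp_path cos0; ring. Qed.

Let rightE : mp_right (r ^+ 2) = mp_path r pi.
Proof. by rewrite /mp_right sqrt_phi /mp_path cospi; ring. Qed.

Lemma mp_path_angle t :
  mp_path r (mp_angle r t) = Num.max (mp_path r 0) (Num.min t (mp_path r pi)).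
Proof.
rewrite /mp_path /mp_angle acosK; last first.
  by rewrite in_itv/= le_max lexx/= ge_max ge_min lexx andbT; lra.
rewrite cos0 cospi.
have r2 : 0 < 2 * r by rewrite mulr_gt0.
have tE : t = 1 + r ^+ 2 - 2 * r * ((1 + r ^+ 2 - t) / (2 * r)).
  by field; rewrite lt0r_neq0.
rewrite {2}tE; set u := _ / _.
have anti x y : (1 + r ^+ 2 - 2 * r * x <= 1 + r ^+ 2 - 2 * r * y) = (y <= x).
  by rewrite lerD2l lerN2 ler_pM2l.
have [u1|u1] := leP u (-1).
  rewrite (min_idPr (_ : u <= 1)); last lra.
  rewrite (max_idPl u1) (min_idPr _) ?anti// (max_idPr _)// anti; lra.
have [u2|u2] := leP 1 u.
  rewrite (max_idPr _); last lra.
  rewrite (min_idPl _) ?anti; last lra.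
  by rewrite (max_idPl _)// anti.
rewrite (max_idPr (ltW u1)) (min_idPl _) ?anti; last lra.
by rewrite (max_idPr _)// anti ltW.
Qed.

Let g (t : R) : R :=
  Num.sqrt (Num.max ((t - mp_path r 0) * (mp_path r pi - t)) 0) /
  (2 * pi * r ^+ 2 * t).

Let g_path (y : R) : 0 <= y <= pi ->
  g (mp_path r y) * (2 * r * sin y) = 2 / pi * (sin y ^+ 2 / mp_path r y).
Proof.
move=> ypi; rewrite /g.
have s0 : 0 <= sin y by rewrite sin_ge0_pi.
have -> : (mp_path r y - mp_path r 0) * (mp_path r pi - mp_path r y) =
    (2 * r * sin y) ^+ 2.
  rewrite exprMn sin2cos2 /mp_path cos0 cospi; ring.
rewrite (max_idPl _) ?sqr_ge0// sqrtr_sqr ger0_norm; last first.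
  by rewrite !mulr_ge0// ltW.
have z0 : mp_path r y != 0 by rewrite lt0r_neq0// mp_path_gt0.
have p0 : (pi : R) != 0 by rewrite lt0r_neq0// pi_gt0.
move: (pi : R) p0 (mp_path r y) z0 => P P0 z z0.
by field; rewrite z0 P0 lt0r_neq0.
Qed.

Let continuous_g (t : R) : 0 < t -> {for t, continuous g}.
Proof.
move=> t0; apply: cvgM; last first.
  apply: cvgV.
    by rewrite !mulf_neq0// ?lt0r_neq0// ?pi_gt0 ?exprn_gt0.
  by apply: cvgMr; exact: cvg_id.
apply: (@continuous_comp _ _ _
  (fun t : R => Num.max ((t - mp_path r 0) * (mp_path r pi - t)) 0) Num.sqrt);
  last exact: sqrt_continuous.
apply: continuous_max; last exact: cst_continuous.
apply: cvgM; apply: cvgB; [exact: cvg_id|exact: cvg_cst|exact: cvg_cst|exact: cvg_id].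
Qed.

Let mp_line_g (A : set R) :
  (mp_line (r ^+ 2) A =
   \int[mu]_(t in A `&` `[mp_path r 0, mp_path r pi]%classic) (g t)%:E)%E.
Proof.
rewrite /mp_line integral_mkcondr; apply: eq_integral => t _.
rewrite /mp_density leftE rightE patchE indicE.
case: ifPn => tab; last first.
  by rewrite mul0r maxxx.
rewrite mul1r -/(g t) (max_idPl _)//.
move: tab; rewrite inE/= in_itv/= => /andP[at_ _].
have t0 : 0 <= t := le_trans (ltW (mp_path_gt0 r0 r1 0)) at_.
apply: divr_ge0; first exact: sqrtr_ge0.
by rewrite mulr_ge0// mulr_ge0 ?sqr_ge0// mulr_ge0// pi_ge0.
Qed.

(** In the angular variable the integrand is [2 / pi] times the derivative of
    [mp_phase], square-root singularities having disappeared. *)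
Let integral_g (y : R) : 0 <= y <= pi ->
  (\int[mu]_(t in `[mp_path r 0, mp_path r y]) (g t)%:E =
  (2 / pi * mp_phase r y)%:E)%E.
Proof.
move=> /andP[]; rewrite le_eqVlt => /predU1P[<- _|y0 ypi].
  by rewrite set_itv1 integral_set1 mp_phase0 mulr0.
have dpath : derive1 (mp_path r) = (fun x => 2 * r * sin x).
  by apply/funext => x; rewrite derive1E; have := is_derive_mp_path r x => h; rewrite derive_val.
have cpath : continuous (mp_path r).
  move=> x; apply/differentiable_continuous/derivable1_diffP.
  by have := is_derive_mp_path r x => h; exact: ex_derive.
have csin : continuous (fun x : R => 2 * r * sin x).
  by move=> x; apply: cvgMr; exact: continuous_sin.
rewrite (integration_by_substitution_increasing (ltW y0)); first last.
- apply: continuous_in_subspaceT => t; rewrite inE/= in_itv/= => /andP[zt _].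
  by apply: continuous_g; rewrite (lt_le_trans (mp_path_gt0 r0 r1 0)).
- split; [|by apply: cvg_at_right_filter; exact: cpath
          |by apply: cvg_at_left_filter; exact: cpath].
  by move=> x _; have := is_derive_mp_path r x => h; exact: ex_derive.
- by rewrite dpath; apply/cvg_ex; exists (2 * r * sin y); apply: cvg_at_left_filter; exact: csin.
- by rewrite dpath; apply/cvg_ex; exists (2 * r * sin 0); apply: cvg_at_right_filter; exact: csin.
- by move=> x _; rewrite dpath; exact: csin.
- move=> u v; rewrite !in_itv/= => /andP[u0 uy] /andP[v0 vy].
  by rewrite mp_path_lt// in_itv/= ?u0 ?v0 (le_trans _ ypi).
transitivity (\int[mu]_(x in `[0%R, y])
    (2 / pi * (sin x ^+ 2 / mp_path r x))%:E)%E.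
  apply: eq_integral => x; rewrite inE/= in_itv/= => /andP[x0 xy].
  rewrite -g_path ?x0 ?(le_trans xy)//.
  by rewrite /GRing.mul/= dpath.
rewrite (@continuous_FTC2 _ _ (fun x => 2 / pi * mp_phase r x))//.
- by rewrite mp_phase0 // mulr0 sube0.
- apply: continuous_in_subspaceT => x _; apply: cvgMr; apply: cvgM.
    by apply: cvgM; exact: continuous_sin.
  by apply: cvgV; [rewrite lt0r_neq0// mp_path_gt0|exact: cpath].
- have cph : continuous (fun x => 2 / pi * mp_phase r x).
    move=> x; apply/differentiable_continuous/derivable1_diffP.
    by have := is_derive_mp_phase r0 r1 x => h; exact: ex_derive.
  split; [|by apply: cvg_at_right_filter; exact: cph
          |by apply: cvg_at_left_filter; exact: cph].
  by move=> x _; have := is_derive_mp_phase r0 r1 x => h; exact: ex_derive.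
- move=> x _; rewrite derive1E; have := is_derive_mp_phase r0 r1 x => h.
  by rewrite derive_val.
Qed.

Lemma mp_line_le (t : R) : mp_line (r ^+ 2) `]-oo, t] = (mp_cdf r t)%:E.
Proof.
rewrite mp_line_g /mp_cdf -integral_g ?mp_angle_ge0 ?mp_angle_lepi//.
rewrite mp_path_angle.
have ab : mp_path r 0 <= mp_path r pi.
  by rewrite ltW// mp_path_lt ?in_itv/= ?pi_gt0 ?pi_ge0 ?lexx.
have [ta|at_] := ltP t (mp_path r 0).
  rewrite (max_idPl _); last by rewrite ge_min (ltW ta).
  rewrite set_itv1 integral_set1 (_ : _ `&` _ = set0) ?integral_set0//.
  apply/seteqP; split=> // x /= []; rewrite !in_itv/= => xt /andP[ax _].
  by have := lt_le_trans ta (le_trans ax xt); rewrite ltxx.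
rewrite (max_idPr _); last by rewrite le_min at_.
congr (integral mu _ _); apply/seteqP; split=> x /=; rewrite !in_itv/= le_min.
  by move=> [-> /andP[-> ->]].
by move=> /and3P[-> -> ->].
Qed.

Lemma mp_line_lt (t : R) : mp_line (r ^+ 2) `]-oo, t[ = (mp_cdf r t)%:E.
Proof.
rewrite -mp_line_le /mp_line integral_itv_bndo_bndc//.
apply/measurable_EFinP/measurable_funTS/measurable_maxr; last exact: measurable_cst.
exact: measurable_mp_density.
Qed.

Lemma mp_lineT : mp_line (r ^+ 2) setT = 1%E.
Proof.
rewrite mp_line_g setTI integral_g ?pi_ge0 ?lexx// mp_phasepi.
by rewrite mulrA divfK ?gt_eqF ?pi_gt0// divff.
Qed.

End mp_distribution.

(** * Kolmogorov distance *)

Section measures_of_half_lines.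
Context {R : realType}.

Lemma real_axis_image (A : set R) (x : R) :
  (real_axis x \in real_axis @` A) = (x \in A).
Proof.
apply/idP/idP; rewrite !inE; first by move=> [y Ay [<-]].
by move=> Ax; exists x.
Qed.

Lemma mp_measure_axis (phi : R) (A : set R) :
  mp_measure phi (real_axis @` A) = mp_line phi A.
Proof.
rewrite /mp_measure /pushforward; congr (mp_line phi _).
apply/seteqP; split=> [x [y Ay [<-]]//|x Ax]; exact: imageP.
Qed.

Lemma measurable_axis_image (A : set R) : measurable A ->
  measurable (real_axis @` A).
Proof.
move=> mA; rewrite (_ : _ @` _ = A `*` [set 0]).
  by apply: measurableX => //; exact: measurable_set1.
apply/seteqP; split=> [_ [x Ax <-]//|[x y] /= [Ax ->]].
by exists x.
Qed.

Lemma sum_nat_mem (A : set R) (rs : seq R) :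
  (\sum_(s <- rs) (s \in A)%:R%:E = (count (fun s => s \in A) rs)%:R%:E :> \bar R)%E.
Proof.
elim: rs => [|s rs IH]; first by rewrite big_nil.
by rewrite big_cons IH /= natrD EFinD.
Qed.

(** Unique factorization identifies the list of complex zeros, up to order,
    with the image of the list of real ones. *)
Lemma laguerre_measure_axis (p : nat) (alpha : R) (rs : seq R) (A : set R) :
  0 < alpha -> size rs = p ->
  rescaled_laguerre p alpha =
    lead_coef (rescaled_laguerre p alpha) *: \prod_(r <- rs) ('X - r%:P) ->
  laguerre_measure p alpha (real_axis @` A) =
  ((count (fun s => s \in A) rs)%:R / p%:R)%:E.
Proof.
move=> alpha0 srs qE.
set q := rescaled_laguerre p alpha in qE *.
have q0 : q != 0 := rescaled_neq0 p alpha0.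
pose C := real_complex R.
have zsE : map_poly C q = lead_coef (map_poly C q) *:
    \prod_(z <- complex_zeros q) ('X - z%:P).
  by rewrite /complex_zeros; case: closed_field_poly_normal.
have perm : perm_eq (complex_zeros q) (map C rs).
  apply: prod_XsubC_eq; rewrite big_map.
  have lc0 : lead_coef (map_poly C q) != 0 by rewrite lead_coef_eq0 map_poly_eq0.
  apply: (scalerI lc0); rewrite -zsE {1}qE map_polyZ lead_coef_map.
  congr (_ *: _); rewrite rmorph_prod; apply: eq_bigr => r _.
  by rewrite rmorphB /= map_polyX map_polyC.
have szs : size (complex_zeros q) = p by rewrite (perm_size perm) size_map.
rewrite /laguerre_measure /= /mscale /= /msum.
transitivity ((p%:R^-1)%:E * \sum_(z <- complex_zeros q)
   (plane_of_complex z \in real_axis @` A)%:R%:E : \bar R)%E.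
  congr (_ * _)%E; rewrite (big_nth 0) szs big_mkord; apply: eq_bigr => k _.
  by rewrite -[LHS]diracE.
rewrite (perm_big _ perm) big_map /=.
rewrite (eq_bigr (fun s => (s \in A)%:R%:E)); last first.
  by move=> s _; rewrite -real_axis_image.
by rewrite sum_nat_mem -EFinM mulrC.
Qed.

(** Cuts treat open and closed end points, and infinite ones, on an equal
    footing: every interval is a difference of two such sets. *)
Definition left_of (l : itv_bound R) : set R := [set x | (BRight x <= l)%O].

Lemma left_of_itv (l u : itv_bound R) :
  [set` Interval l u] = left_of u `\` left_of l.
Proof.
have gap x : (l <= BLeft x)%O = ~~ (BRight x <= l)%O.
  by case: l => [[] y|[]]; rewrite ?bnd_simp // -?leNgt -?ltNge.
apply/seteqP; split=> x; rewrite /left_of /= itv_boundlr gap.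
  by move=> /andP[/negP ? ?].
by move=> [h1 /negP h2]; rewrite h1 h2.
Qed.

Lemma left_of_le (l u : itv_bound R) : (l <= u)%O -> left_of l `<=` left_of u.
Proof. by move=> lu x /= h; exact: le_trans lu. Qed.

Lemma measurable_left_of (l : itv_bound R) : measurable (left_of l).
Proof.
rewrite (_ : left_of l = [set` Interval -oo%O l]); first exact: measurable_itv.
by apply/seteqP; split=> x; rewrite /= itv_boundlr.
Qed.

End measures_of_half_lines.

Section kolmogorov.
Context {R : realType} (p : nat) (alpha : R).
Context (alpha0 : 0 < alpha) (p2 : (2 <= p)%N).
Let phi : R := p%:R / (p%:R + alpha).

Let laguerre_mp_setup : exists (r : R) (rs : seq R),
  [/\ [/\ 0 < r, r < 1, phi = r ^+ 2 & (p%:R + alpha) * r ^+ 2 = p%:R],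
      size rs = p, path <%R 0 rs,
      rescaled_laguerre p alpha = lead_coef (rescaled_laguerre p alpha) *:
        \prod_(s <- rs) ('X - s%:P) &
      forall s, root (rescaled_laguerre p alpha) s = (s \in rs)].
Proof.
have p0 : 0 < p%:R :> R by rewrite ltr0n; case: p p2.
have N0 : 0 < p%:R + alpha by rewrite addr_gt0.
have phi0 : 0 < phi by rewrite divr_gt0.
pose r := Num.sqrt phi.
have r0 : 0 < r by rewrite sqrtr_gt0.
have phiE : phi = r ^+ 2 by rewrite sqr_sqrtr// ltW.
have Nr2 : (p%:R + alpha) * r ^+ 2 = p%:R.
  by rewrite -phiE /phi mulrCA divff ?mulr1// lt0r_neq0.
have r1 : r < 1.
  by rewrite -(@expr_lt1 _ 2)// ?ltW// -phiE /phi ltr_pdivrMr// mul1r ltrDl.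
have [rs [srs prs qE]] := rescaled_factor p alpha0.
exists r, rs; split => // s.
rewrite qE rootZ ?root_prod_XsubC// lead_coef_eq0.
exact: rescaled_neq0.
Qed.

(** The measures are compared on all half-lines, open or closed, at the price of
    at most [9 ln p] zeros. *)
Lemma kolmogorov (l : itv_bound R) : exists x y : R,
  [/\ laguerre_measure p alpha (real_axis @` left_of l) = x%:E,
      mp_measure phi (real_axis @` left_of l) = y%:E &
      `|x - y| <= 9 * (ln p%:R / p%:R)].
Proof.
have p0 : 0 < p%:R :> R by rewrite ltr0n; case: p p2.
have [r [rs [[r0 r1 phiE Nr2] srs prs qE qrsE]]] := laguerre_mp_setup.
have qrs s : root (rescaled_laguerre p alpha) s -> s \in rs by rewrite qrsE.
have lp : 0 <= 9 * (ln p%:R / p%:R) :> R.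
  by rewrite mulr_ge0// divr_ge0 ?(ltW p0)//; have := @ln_nat_ge_half R p p2; lra.
have lower t := count_lt_ge alpha0 r0 Nr2 p2 qrs t.
have upper t := count_le_le alpha0 r0 Nr2 p2 srs qrs t.
have ltle t : (count (fun s => s < t) rs)%:R <= (count (fun s => s <= t) rs)%:R :> R.
  by rewrite ler_nat; apply: sub_count => s /ltW.
have close (n : nat) t :
   p%:R * mp_cdf r t - 9 * ln p%:R <= n%:R ->
   n%:R <= p%:R * mp_cdf r t + 9 * ln p%:R ->
   `|n%:R / p%:R - mp_cdf r t| <= 9 * (ln p%:R / p%:R).
  move=> h1 h2.
  have -> : n%:R / p%:R - mp_cdf r t = (n%:R - p%:R * mp_cdf r t) / p%:R.
    by field; rewrite lt0r_neq0.
  rewrite normrM normfV (gtr0_norm p0) mulrA ler_pM2r ?invr_gt0//.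
  by rewrite ler_norml; apply/andP; split; lra.
rewrite mp_measure_axis (laguerre_measure_axis _ alpha0 srs qE) phiE.
case: l => [[] t|[]].
- exists ((count (fun s => s < t) rs)%:R / p%:R), (mp_cdf r t); split.
  + by congr (_%:R / _)%:E; apply: eq_count => s; apply/idP/idP => [/set_mem|/mem_set].
  + rewrite (_ : left_of _ = `]-oo, t[%classic) ?(mp_line_lt r0 r1)//.
  + by apply: close; [exact: lower|exact: le_trans (upper t)].
- exists ((count (fun s => s <= t) rs)%:R / p%:R), (mp_cdf r t); split.
  + by congr (_%:R / _)%:E; apply: eq_count => s; apply/idP/idP => [/set_mem|/mem_set].
  + rewrite (_ : left_of _ = `]-oo, t]%classic) ?(mp_line_le r0 r1)//.
  + by apply: close; [exact: le_trans (ltle t)|exact: upper].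
- exists 0, 0; split.
  + rewrite (@eq_count _ _ pred0) ?count_pred0 ?mul0r// => s.
    by apply/negP => /set_mem.
  + rewrite (_ : left_of _ = set0) ?measure0//.
    by apply/seteqP; split=> // x.
  + by rewrite subrr normr0.
- exists 1, 1; split.
  + rewrite (@eq_count _ _ predT) ?count_predT ?srs ?divff ?lt0r_neq0// => s.
    by apply/mem_set.
  + rewrite (_ : left_of _ = setT) ?(mp_lineT r0 r1)//.
    by apply/seteqP; split=> // x.
  + by rewrite subrr normr0.
Qed.

(** Positivity of the zeros and the bound [rescaled_root_lt6]. *)
Lemma laguerre_cdf01 :
  laguerre_measure p alpha (real_axis @` left_of (BRight 0)) = 0%E /\
  laguerre_measure p alpha (real_axis @` left_of (BRight 6)) = 1%E.
Proof.
have p0 : 0 < p%:R :> R by rewrite ltr0n; case: p p2.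
have [r [rs [_ srs prs qE qrsE]]] := laguerre_mp_setup.
rewrite !(laguerre_measure_axis _ alpha0 srs qE); split.
  rewrite (@eq_in_count _ _ pred0) ?count_pred0 ?mul0r// => s srs'.
  apply/negbTE/negP => /set_mem s0.
  have := order_path_min lt_trans prs => /allP/(_ _ srs').
  by rewrite ltNge => /negP; apply.
rewrite (@eq_in_count _ _ predT) ?count_predT ?srs ?divff ?lt0r_neq0// => s srs'.
apply/mem_set; apply/ltW/(@rescaled_root_lt6 _ p alpha alpha0).
  by case: p p2.
by rewrite qrsE.
Qed.

Lemma mp_cdf01 :
  mp_measure phi (real_axis @` left_of (BRight 0)) = 0%E /\
  mp_measure phi (real_axis @` left_of (BRight 6)) = 1%E.
Proof.
have [r [rs [[r0 r1 phiE _] _ _ _ _]]] := laguerre_mp_setup.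
have r2 : 0 < 2 * r by rewrite mulr_gt0.
have sq : 0 <= (1 - r) ^+ 2 by exact: sqr_ge0.
have sq' : (1 + r) ^+ 2 <= 4.
  by rewrite -[4](_ : 2 ^+ 2 = 4 :> R) ?lerXn2r ?nnegrE//; [lra|lra|rewrite -natrX].
have e1 : (1 + r) ^+ 2 = 1 + r ^+ 2 + 2 * r by ring.
have e2 : (1 - r) ^+ 2 = 1 + r ^+ 2 - 2 * r by ring.
rewrite !mp_measure_axis phiE ![mp_line _ _](mp_line_le r0 r1) /mp_cdf /mp_angle.
split; congr (_%:E).
  rewrite subr0 (min_idPl _); last by rewrite ler_pdivlMr//; lra.
  by rewrite (max_idPr _) ?acos1 ?mp_phase0 ?mulr0//; lra.
have u1 : (1 + r ^+ 2 - 6) / (2 * r) <= -1 by rewrite ler_pdivrMr//; lra.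
rewrite (min_idPr _); last by apply: (le_trans u1); lra.
rewrite (max_idPl u1) acosN1 mp_phasepi.
by rewrite mulrA divfK ?gt_eqF ?pi_gt0// divff.
Qed.

Lemma laguerre_measureT : laguerre_measure p alpha setT = 1%E.
Proof.
have p0 : 0 < p%:R :> R by rewrite ltr0n; case: p p2.
rewrite /laguerre_measure /= /mscale /= /msum.
rewrite (eq_bigr (fun=> 1%E)); last by move=> k _; exact: diracT.
by rewrite sumEFin sumr_const card_ord -EFinM mulVf// lt0r_neq0.
Qed.

Lemma mp_measureT : mp_measure phi setT = 1%E.
Proof.
have [r [rs [[r0 r1 phiE _] _ _ _ _]]] := laguerre_mp_setup.
by rewrite /mp_measure /pushforward preimage_setT phiE; exact: mp_lineT.
Qed.

End kolmogorov.

(** * Integration against measures on the real axis *)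

Section plane_measurability.
Context {R : realType}.

(** Open sets are countable unions of boxes with rational centres. *)
Lemma measurable_open_plane (U : set (R * R)) : open U -> measurable U.
Proof.
move=> oU.
pose box (q1 q2 : rat) (n : nat) : set (R * R) :=
  ball (ratr q1 : R) n.+1%:R^-1 `*` ball (ratr q2 : R) n.+1%:R^-1.
pose F q1 q2 n := if `[< box q1 q2 n `<=` U >] then box q1 q2 n else set0.
have -> : U = \bigcup_q1 \bigcup_q2 \bigcup_n F q1 q2 n.
  apply/seteqP; split=> [[x y] Uxy|z [q1 _ [q2 _ [n _]]]]; last first.
    by rewrite /F; case: asboolP => // bU; exact: bU.
  have := open_nbhs_nbhs (conj oU Uxy); rewrite -nbhs_ballE => -[e /= e0 eU].
  have [n ne] : exists n, n.+1%:R^-1 < e / 2 :> R.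
    have e2 : 0 < e / 2 by rewrite divr_gt0.
    exists (Num.truncn ((e / 2)^-1)).
    by rewrite invf_plt ?posrE// truncnS_gt.
  have n0 : 0 < n.+1%:R^-1 :> R by rewrite invr_gt0.
  have sep (t : R) : t - n.+1%:R^-1 < t + n.+1%:R^-1.
    by rewrite ltrD2l (@lt_trans _ _ 0)// oppr_lt0.
  have [q1] := @rat_in_itvoo R (x - n.+1%:R^-1) (x + n.+1%:R^-1) (sep x).
  rewrite in_itv/= => /andP[q1l q1u].
  have [q2] := @rat_in_itvoo R (y - n.+1%:R^-1) (y + n.+1%:R^-1) (sep y).
  rewrite in_itv/= => /andP[q2l q2u].
  have xy : box q1 q2 n (x, y).
    split; rewrite /ball/= ltr_norml; apply/andP; split;
      move: q1l q1u q2l q2u; move: (n.+1%:R^-1) => d *; lra.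
  exists q1 => //; exists q2 => //; exists n => //.
  rewrite /F; case: asboolP => // -[] [x' y'] [/=].
  rewrite /ball/= !ltr_norml => /andP[a1 a2] /andP[b1 b2].
  apply: eU; split; rewrite /ball/= ltr_norml; apply/andP; split;
    move: q1l q1u q2l q2u a1 a2 b1 b2 ne; move: (n.+1%:R^-1) => d *; lra.
apply: bigcupT_measurable_rat => q1; apply: bigcupT_measurable_rat => q2.
apply: bigcupT_measurable => n; rewrite /F; case: ifP => _ //.
by apply: measurableX; exact: measurable_ball.
Qed.

Lemma measurable_continuous_plane (f : R * R -> R) : continuous f ->
  measurable_fun setT f.
Proof.
move=> /continuousP cf; apply: (measurability _ (RGenOpens.measurableE R)).
move=> _ [_ [a [b ->] <-]]; rewrite setTI; apply: measurable_open_plane.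
by apply: cf; exact: interval_open.
Qed.

Lemma measurable_lne_fun d (T : measurableType d) (g : T -> R) :
  measurable_fun setT g -> measurable_fun setT (fun t => lne (g t)%:E).
Proof.
move=> mg.
rewrite (_ : (fun t => _) =
    fun t => if (g t <= 0) then -oo%E else (ln (g t))%:E); last first.
  apply/funext => t; case: ifPn => gt; first by rewrite le0_lneNy.
  by rewrite lne_EFin// ltNge.
apply: measurable_fun_ifT => //.
  by apply: measurable_fun_ler => //; exact: measurable_cst.
apply/measurable_EFinP; apply: measurableT_comp mg; exact: measurable_ln.
Qed.

End plane_measurability.

Section quadrature.
Context {R : realType}.
Context (m : {measure set (R * R) -> \bar R}) (L : R -> R) (B : R).
Context (mL : forall t, m (real_axis @` `]-oo, t]) = (L t)%:E).
Context (L0 : L 0 = 0) (LB : L B = 1) (mT : m setT = 1%E).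

Lemma left_cdf_le (s t : R) : s <= t -> L s <= L t.
Proof.
move=> st; rewrite -lee_fin -!mL; apply: le_measure.
- by rewrite inE; apply: measurable_axis_image; exact: measurable_itv.
- by rewrite inE; apply: measurable_axis_image; exact: measurable_itv.
- by apply: image_subset => x /=; rewrite !in_itv/= => xs; exact: le_trans st.
Qed.

Let axis_itv (s t : R) : set (R * R) := real_axis @` `]s, t].

Let m_axis_itv s t : s <= t -> m (axis_itv s t) = (L t - L s)%:E.
Proof.
move=> st.
have E : real_axis @` `]-oo, t] = real_axis @` `]-oo, s] `|` axis_itv s t.
  rewrite /axis_itv -image_setU; congr (_ @` _).
  by rewrite -itv_bndbnd_setU// bnd_simp.
have : m (real_axis @` `]-oo, t]) = (m (real_axis @` `]-oo, s]) + m (axis_itv s t))%E.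
  rewrite E measureU//; try by apply: measurable_axis_image; exact: measurable_itv.
  apply/seteqP; split=> // _ [[x + <-] [y + [yx]]].
  rewrite /= !in_itv/= yx => xs /andP[sx _].
  by have := lt_le_trans sx xs; rewrite ltxx.
rewrite !mL EFinB => ->.
by rewrite addeAC subee// add0e.
Qed.

Let maxis s t : measurable (axis_itv s t).
Proof. by apply: measurable_axis_image; exact: measurable_itv. Qed.

Let B0 : 0 <= B.
Proof.
rewrite leNgt; apply/negP => /ltW /left_cdf_le; rewrite L0 LB.
by rewrite ler10.
Qed.

Let null : m (~` axis_itv 0 B) = 0%E.
Proof.
have : (1 = m (axis_itv 0 B) + m (~` axis_itv 0 B))%E.
  rewrite -(measureU m (maxis 0 B) (measurableC (maxis 0 B))) ?setICr//.
  by rewrite setUv; exact: esym mT.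
rewrite m_axis_itv// L0 LB subr0.
case: (m _) => [x||] //= [] x0; congr (_%:E); lra.
Qed.

(** As the measure has mass one and lives on [0, B], the Riemann-Stieltjes sum
    differs from the integral by at most the oscillation on a cell. *)
Lemma quadrature (f : R * R -> \bar R) (h : R -> R) (M : nat) (c : nat -> R)
    (w : R) : measurable_fun setT f ->
  (forall t, 0 < t <= B -> f (real_axis t) = (h t)%:E) ->
  c 0%N = 0 -> c M = B -> (forall j, c j <= c j.+1) ->
  (forall j t, (j < M)%N -> c j < t <= c j.+1 -> `|h t - h (c j.+1)| <= w) ->
  exists2 I : R, (\int[m]_z f z = I%:E)%E &
    `|I - \sum_(j < M) h (c j.+1) * (L (c j.+1) - L (c j))| <= w.
Proof.
move=> mf fh c0 cM cinc hw.
have cle : {homo c : i j / (i <= j)%N >-> i <= j}.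
  by apply: homo_leq => // x y z; exact: le_trans.
have -> : (\int[m]_z f z = \int[m]_(z in axis_itv 0 B) f z)%E.
  rewrite [RHS]integral_mkcond; apply: ae_eq_integral => //.
    by apply/(measurable_restrictT _ _).1 => //; exact: measurable_funTS.
  exists (~` axis_itv 0 B); split => //; first exact: measurableC.
  move=> z /= nz zD; apply: nz => _; rewrite patchE.
  by case: ifPn => //; rewrite notin_setE.
rewrite -cM.
suff J n : (n <= M)%N -> exists2 I : R,
    (\int[m]_(z in axis_itv 0 (c n)) f z = I%:E)%E &
    `|I - \sum_(j < n) h (c j.+1) * (L (c j.+1) - L (c j))| <= w * (L (c n) - L 0).
  have [I IE Iw] := J M (leqnn M); exists I => //.
  by move: Iw; rewrite cM LB L0 subr0 mulr1.
elim: n => [_|n IH nM].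
  exists 0; rewrite ?big_ord0 ?subr0 ?c0 ?subrr ?mulr0 ?normr0//.
  by rewrite /axis_itv set_itvoc0 image_set0 integral_set0.
have [I IE Iw] := IH (ltnW nM).
have c0n : 0 <= c n by rewrite -c0 cle.
have cellU : axis_itv 0 (c n.+1) = axis_itv 0 (c n) `|` axis_itv (c n) (c n.+1).
  rewrite /axis_itv -image_setU; congr (_ @` _).
  by rewrite -itv_bndbnd_setU ?bnd_simp.
pose C := axis_itv (c n) (c n.+1).
have mC : m C = (L (c n.+1) - L (c n))%:E by rewrite m_axis_itv.
have fC z : C z -> exists2 x : R, f z = x%:E & h (c n.+1) - w <= x <= h (c n.+1) + w.
  move=> [t /=]; rewrite in_itv/= => /andP[ct tc] <-; exists (h t).
    apply: fh; rewrite (le_lt_trans c0n ct) (le_trans tc)// -cM; exact: cle.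
  by rewrite -ler_distl hw// ct.
have intc (k : R) : m.-integrable C (cst k%:E).
  apply/integrableP; split => //; rewrite /= integral_cst; last exact: maxis.
  by rewrite mC -EFinM ltry.
have intf : m.-integrable C f.
  apply: (le_integrable _ _ _ (intc (`|h (c n.+1)| + `|w|))).
  - exact: maxis.
  - exact: measurable_funTS.
  - move=> z /fC[x -> /andP[h1 h2]] /=; rewrite lee_fin.
    rewrite [leRHS]ger0_norm ?addr_ge0//.
    have := ler_norm (h (c n.+1)); have := lerNnormlW (lexx `|h (c n.+1)|).
    have := ler_norm w => a1 a2 a3.
    by rewrite ler_norml; apply/andP; split; lra.
have [K KE] : exists K : R, (\int[m]_(z in C) f z = K%:E)%E.
  by exists (fine (\int[m]_(z in C) f z)%E); rewrite fineK//;
    apply: integrable_fin_num => //; exact: maxis.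
have K1 : (h (c n.+1) - w) * (L (c n.+1) - L (c n)) <= K.
  rewrite -lee_fin -KE EFinM -mC -integral_cst//; last exact: maxis.
  apply: le_integral => //; first exact: maxis.
  by move=> z; rewrite inE => /fC[x -> /andP[h1 h2]]; rewrite lee_fin.
have K2 : K <= (h (c n.+1) + w) * (L (c n.+1) - L (c n)).
  rewrite -lee_fin -KE EFinM -mC -integral_cst//; last exact: maxis.
  apply: le_integral => //; first exact: maxis.
  by move=> z; rewrite inE => /fC[x -> /andP[h1 h2]]; rewrite lee_fin.
exists (I + K).
  rewrite cellU integral_setU; first by rewrite IE KE.
  - exact: maxis.
  - exact: maxis.
  - exact: measurable_funTS.
  - apply/disj_setPS => _ [[x + <-] [y + [yx]]].
    rewrite /= !in_itv/= yx => /andP[_ xs] /andP[sx _].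
    by have := lt_le_trans sx xs; rewrite ltxx.
rewrite big_ord_recr/=; move: Iw; set S := \sum_(_ < n) _.
rewrite !ler_norml => /andP[i1 i2]; apply/andP; split; move: K1 K2;
  rewrite !mulrDl mulNr; lra.
Qed.

End quadrature.

(** * Integrable majorants on the plane *)

Section kernel_integral.
Context {R : realType}.
Let mu := @lebesgue_measure R.
Local Open Scope ereal_scope.

(** The integral of a nonnegative function is a supremum over the simple
    functions below it; this applies to a difference of potentials as it stands. *)
Lemma le_integral_majorant d (T : measurableType d) (m : {measure set T -> \bar R})
    (f g : T -> \bar R) : (forall x, 0 <= f x) -> (forall x, f x <= g x) ->
  \int[m]_x f x <= \int[m]_x g x.
Proof.
move=> f0 fg; have g0 x : 0 <= g x := le_trans (f0 x) (fg x).
rewrite !ge0_integralTE//; apply: le_ereal_sup => _ [h hf <-].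
by exists h => // x; exact: le_trans (fg x).
Qed.

Definition kern (y : R) : R := (Num.sqrt `|y| * (1 + `|y|))^-1.

Lemma kern_ge0 y : (0 <= kern y)%R.
Proof. by rewrite invr_ge0 mulr_ge0 ?sqrtr_ge0// addr_ge0. Qed.

Lemma continuous_kern y : y != 0%R -> {for y, continuous kern}.
Proof.
move=> y0; apply: cvgV.
  by rewrite mulf_neq0// ?gt_eqF ?sqrtr_gt0 ?normr_gt0 ?ltr_pwDl.
apply: cvgM.
  apply: (@continuous_comp _ _ _ (fun y : R => `|y|%R) Num.sqrt).
    exact: norm_continuous.
  exact: sqrt_continuous.
by apply: cvgD; [exact: cvg_cst|exact: norm_continuous].
Qed.

Lemma measurable_kern : measurable_fun [set: R] kern.
Proof.
have mf : measurable_fun [set: R] (fun y : R => Num.sqrt `|y| * (1 + `|y|))%R.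
  apply: measurable_funM.
    apply: measurableT_comp; last exact: normr_measurable.
    by apply: continuous_measurable_fun; exact: sqrt_continuous.
  by apply: measurable_funD; [exact: measurable_cst|exact: normr_measurable].
(* Inversion is discontinuous at 0; the power -1 is known to be measurable. *)
rewrite (_ : kern = (fun y => (Num.sqrt `|y| * (1 + `|y|)) `^ (-1))%R).
  by apply: (measurableT_comp (measurable_powR _)); exact: mf.
apply/funext => y; rewrite powR_inv1// mulr_ge0 ?sqrtr_ge0// addr_ge0//.
Qed.

(** A primitive is [2 atan (sqrt y)]. *)
Lemma integral_kern_pos (a : R) : (0 < a)%R ->
  \int[mu]_(y in `[a, +oo[) (kern y)%:E <= pi%:E.
Proof.
move=> a0; pose F (y : R) := (2 * atan (Num.sqrt y))%R.
have dF (y : R) : (0 < y)%R -> is_derive y (1%R : R) F (kern y).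
  move=> y0; have ds := is_derive1_sqrt y0.
  rewrite /F; apply: is_derive_eq; rewrite /GRing.scale/= /kern gtr0_norm//.
  rewrite sqr_sqrtr ?ltW//.
  have s0 : (Num.sqrt y != 0)%R by rewrite gt_eqF// sqrtr_gt0.
  have y1 : (1 + y != 0)%R by rewrite gt_eqF// addr_gt0.
  by field; rewrite s0 y1.
rewrite (@ge0_continuous_FTC2y _ kern F a pi).
- rewrite -EFinB lee_fin lerBlDr lerDl mulr_ge0//.
  by rewrite -(@atan0 R) le_atan// sqrtr_ge0.
- by move=> y _; exact: kern_ge0.
- apply: continuous_in_subspaceT => y; rewrite inE/= in_itv/= andbT => ay.
  by apply: continuous_kern; rewrite gt_eqF// (lt_le_trans a0).
- rewrite -[X in _ --> X](_ : 2 * (pi / 2) = pi)%R; last by rewrite mulrC divfK.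
  apply: cvgMr; apply: (cvg_comp (fun y : R => Num.sqrt y) (@atan R)); last exact: cvgy_atan.
  apply/cvgryPge => A; near=> y.
  have A2 : (A ^+ 2 <= y)%R by near: y; apply: nbhs_pinfty_ge; exact: num_real.
  by rewrite (le_trans (ler_norm A))// -sqrtr_sqr ler_wsqrtr.
- by move=> y ay; have := dF y (lt_trans a0 ay) => h; exact: ex_derive.
- apply: cvg_at_right_filter; apply/differentiable_continuous/derivable1_diffP.
  by have := dF a a0 => h; exact: ex_derive.
- move=> y; rewrite in_itv/= andbT => ay; rewrite derive1E.
  by have := dF y (lt_trans a0 ay) => h; rewrite derive_val.
Unshelve. all: by end_near. Qed.

(** The value at 0 makes the pointwise bounds hold on the whole plane, including
    the real axis, where a potential may be infinite. *)
Definition ekern (y : R) : \bar R := if y == 0%R then +oo else (kern y)%:E.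

Lemma ekern_ge0 y : 0 <= ekern y.
Proof. by rewrite /ekern; case: ifP => // _; rewrite lee_fin kern_ge0. Qed.

Lemma measurable_ekern : measurable_fun [set: R] ekern.
Proof.
apply: measurable_fun_ifT => //.
  by apply: measurable_fun_eqr => //; exact: measurable_cst.
by apply/measurable_EFinP; exact: measurable_kern.
Qed.

(** The singularity at 0 is exhausted by the sets where [|y| >= 1 / (n + 1)]. *)
Lemma integral_ekern : \int[mu]_y ekern y <= (2 * pi)%:E.
Proof.
have a0 n : (0 < n.+1%:R^-1 :> R)%R by rewrite invr_gt0.
pose E n : set R := `]-oo, (- n.+1%:R^-1)%R] `|` `[n.+1%:R^-1%R, +oo[.
have mE n : measurable (E n) by apply: measurableU; exact: measurable_itv.
have EU : [set: R] `\` [set 0%R] = \bigcup_n E n.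
  apply/seteqP; split=> [y [_ /eqP y0]|y [n _]].
    have ny : (0 < `|y|)%R by rewrite normr_gt0.
    have [n ny1] : exists n, (n.+1%:R^-1 < `|y|)%R.
      by exists (Num.truncn (`|y|^-1)%R); rewrite invf_plt ?posrE// truncnS_gt.
    exists n => //; rewrite /E /= !in_itv/= andbT.
    by have [y1|y1] := leP 0%R y; [right; move: ny1; rewrite ger0_norm// => /ltW|
       left; move: ny1; rewrite ltr0_norm// ltrNr => /ltW].
  rewrite /E /= !in_itv/= andbT => -[] yn; split=> // y0; move: yn; rewrite y0.
    by rewrite lerNr oppr0 leNgt a0.
  by rewrite leNgt a0.
have ndE : nondecreasing_seq E.
  apply/nondecreasing_seqP => n; rewrite subsetEset => y.
  have n12 : (n.+2%:R^-1 <= n.+1%:R^-1 :> R)%R by rewrite lef_pV2 ?posrE// ler_nat.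
  rewrite /E /= !in_itv/= !andbT => -[] yn; [left|right].
    by rewrite (le_trans yn)// lerN2.
  exact: le_trans yn.
have bound n : \int[mu]_(y in E n) ekern y <= (2 * pi)%:E.
  have nE y : E n y -> y != 0%R.
    move=> Ey; have : (\bigcup_n E n) y by exists n.
    by rewrite -EU => -[_ /eqP].
  rewrite (@eq_integral _ _ _ mu (E n) (EFin \o kern)); last first.
    by move=> y; rewrite inE => /nE /negbTE y0; rewrite /ekern y0.
  have mk (D : set R) : measurable_fun D (EFin \o kern).
    by apply: measurable_funTS; apply/measurable_EFinP; exact: measurable_kern.
  rewrite ge0_integral_setU//=.
  + rewrite (_ : 2 * pi = pi + pi)%R; last by rewrite mulr2n mulrDl !mul1r.
    rewrite EFinD; apply: leeD; last exact: integral_kern_pos.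
    rewrite ge0_integration_by_substitutionNy//.
    * rewrite (@eq_integral _ _ _ mu _ (EFin \o kern)); first exact: integral_kern_pos.
      by move=> y _; rewrite /= /kern normrN.
    * apply: continuous_in_subspaceT => y; rewrite inE/= in_itv/= => yn.
      apply: continuous_kern; rewrite lt_eqF// (le_lt_trans yn)// oppr_lt0//.
    * by move=> y _; exact: kern_ge0.
  + exact: mk.
  + by move=> y _; rewrite lee_fin kern_ge0.
  + apply/disj_setPS => y [] /=; rewrite !in_itv/= andbT => y1 y2.
    by have := le_trans y2 y1; rewrite leNgt (@lt_trans _ _ 0%R)// oppr_lt0.
have mek D : measurable_fun D ekern by apply: measurable_funTS; exact: measurable_ekern.
have -> : \int[mu]_y ekern y = \int[mu]_(y in [set: R] `\` [set 0%R]) ekern y.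
  apply: (@ge0_negligible_integral _ (measurableTypeR R) R (@lebesgue_measure R)
    setT [set 0%R] ekern) => //.
  - exact: mek.
  - by move=> y _; exact: ekern_ge0.
  - exact: lebesgue_measure_set1.
rewrite EU.
have cvg : \int[mu]_(y in E n) ekern y @[n --> \oo] -->
    \int[mu]_(y in \bigcup_n E n) ekern y.
  have Ege0 n y : E n y -> 0 <= ekern y by move=> _; exact: ekern_ge0.
  exact: (@ge0_nondecreasing_set_cvg_integral _ (measurableTypeR R) R E ekern
    (@lebesgue_measure R) ndE mE (fun n => mek (E n)) Ege0).
rewrite -(cvg_lim _ cvg)//; apply: lime_le; first exact: cvgP cvg.
exact: nearW.
Qed.

Lemma integral_inv_oneDsqr : \int[mu]_x ((1 + x ^+ 2)^-1)%:E = pi%:E.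
Proof.
rewrite (@ge0_symfun_integralT _ (fun x => (1 + x ^+ 2)^-1)%R).
- rewrite (_ : [set x | _] = `[0%R, +oo[%classic); last first.
    by apply/seteqP; split=> x; rewrite /= in_itv/= andbT.
  rewrite (integral0y_oneDsqr R) -EFinM mulrC divfK//.
- by move=> x; rewrite invr_ge0 addr_ge0// sqr_ge0.
- exact: continuous_oneDsqrV.
- by move=> x; rewrite /= sqrrN.
Qed.

End kernel_integral.

(** * From distribution functions to integrals *)

Section comparison.
Context {R : realType}.
Context (m1 m2 : {measure set (R * R) -> \bar R}) (L1 L2 : R -> R) (B K : R).
Context (mL1 : forall t, m1 (real_axis @` `]-oo, t]) = (L1 t)%:E).
Context (mL2 : forall t, m2 (real_axis @` `]-oo, t]) = (L2 t)%:E).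
Context (L10 : L1 0 = 0) (L20 : L2 0 = 0) (L1B : L1 B = 1) (L2B : L2 B = 1).
Context (m1T : m1 setT = 1%E) (m2T : m2 setT = 1%E).
Context (LK : forall t, `|L1 t - L2 t| <= K).

(** Summation by parts moves the differences from the distribution functions
    to the integrand. *)
Lemma compare_integrals (f : R * R -> \bar R) (h : R -> R) (M : nat) (w : R) :
  measurable_fun setT f -> (0 < M)%N ->
  (forall t, 0 < t <= B -> f (real_axis t) = (h t)%:E) ->
  (forall s t, 0 <= s -> s <= t <= B -> t - s <= B / M%:R -> `|h s - h t| <= w) ->
  exists I1 I2 : R, [/\ (\int[m1]_z f z = I1%:E)%E, (\int[m2]_z f z = I2%:E)%E &
    `|I1 - I2| <= 2 * w +
      K * \sum_(j < M) `|h (B * (j.+1%:R / M%:R)) - h (B * (j%:R / M%:R))|].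
Proof.
move=> mf M0 fh hw.
have B0 : 0 <= B.
  rewrite leNgt; apply/negP => /ltW /(left_cdf_le mL1); rewrite L10 L1B.
  by rewrite ler10.
have Mgt0 : 0 < M%:R :> R by rewrite ltr0n.
pose c (j : nat) : R := B * (j%:R / M%:R).
have cS j : c j.+1 - c j = B / M%:R.
  by rewrite /c -mulrBr -mulrBl -natr1 addrAC subrr add0r mul1r.
have cle j : c j <= c j.+1 by rewrite -subr_ge0 cS divr_ge0// ltW.
have c0 : c 0%N = 0 by rewrite /c mul0r mulr0.
have cM : c M = B by rewrite /c divff ?mulr1// lt0r_neq0.
have cmono : {homo c : i j / (i <= j)%N >-> i <= j}.
  by apply: homo_leq => // x y z; exact: le_trans.
have osc j t : (j < M)%N -> c j < t <= c j.+1 -> `|h t - h (c j.+1)| <= w.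
  move=> jM /andP[ct tc]; apply: hw.
  - by rewrite (le_trans _ (ltW ct))// -c0 cmono.
  - by rewrite tc -cM cmono.
  - by rewrite -(cS j) lerD2l lerN2 ltW.
have [I1 I1E I1w] := quadrature mL1 L10 L1B m1T mf fh c0 cM cle osc.
have [I2 I2E I2w] := quadrature mL2 L20 L2B m2T mf fh c0 cM cle osc.
exists I1, I2; split => //.
pose D j := L1 (c j) - L2 (c j).
have abel n : \sum_(j < n) h (c j.+1) * (L1 (c j.+1) - L1 (c j)) -
    \sum_(j < n) h (c j.+1) * (L2 (c j.+1) - L2 (c j)) =
    h (c n) * D n - h (c 0%N) * D 0%N - \sum_(j < n) (h (c j.+1) - h (c j)) * D j.
  elim: n => [|n IH]; first by rewrite !big_ord0; ring.
  by rewrite !big_ord_recr/= opprD addrACA IH /D; ring.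
have DM : D M = 0 by rewrite /D cM L1B L2B subrr.
have D0 : D 0%N = 0 by rewrite /D c0 L10 L20 subrr.
have sumK : `|\sum_(j < M) (h (c j.+1) - h (c j)) * D j| <=
    K * \sum_(j < M) `|h (c j.+1) - h (c j)|.
  apply: (le_trans (ler_norm_sum _ _ _)); rewrite mulr_sumr; apply: ler_sum => j _.
  by rewrite normrM mulrC ler_wpM2r// LK.
have := abel M; rewrite DM D0 !mulr0 subrr sub0r => abM.
rewrite -normrN -abM in sumK.
move: I1w I2w sumK; rewrite -/(c _).
set S1 := \sum_(_ < _) _; set S2 := \sum_(_ < _) _; set S := K * _.
by rewrite !ler_norml => /andP[? ?] /andP[? ?] /andP[? ?]; apply/andP; split; lra.
Qed.

End comparison.

(** * The logarithmic kernel on the axis *)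

Section logarithm_on_the_axis.
Context {R : realType} (x y : R) (y0 : y != 0).

Let H (u : R) : R := ln (Num.sqrt (u ^+ 2 + y ^+ 2)).

Let yy_gt0 : 0 < y ^+ 2. Proof. by rewrite exprn_even_gt0. Qed.

Let sum_gt0 (u : R) : 0 < u ^+ 2 + y ^+ 2.
Proof. by rewrite ltr_wpDl// sqr_ge0. Qed.

Let H_le (u v : R) : `|u| <= `|v| -> H u <= H v.
Proof.
move=> uv; rewrite /H ler_ln ?posrE ?sqrtr_gt0// ler_wsqrtr// lerD2r.
by rewrite -(real_normK (num_real u)) -(real_normK (num_real v)) lerXn2r ?nnegrE.
Qed.

Definition axis_log (t : R) : R := H (x - t).

(** From [ln u <= u - 1] and the triangle inequality. *)
Lemma axis_log_lip (s t : R) : `|axis_log s - axis_log t| <= `|s - t| / `|y|.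
Proof.
wlog st : s t / axis_log t <= axis_log s.
  move=> wh; have [|/ltW ts] := leP (axis_log t) (axis_log s); first exact: wh.
  by rewrite distrC (distrC s); exact: wh.
rewrite ger0_norm ?subr_ge0// /axis_log /H -ln_div ?posrE ?sqrtr_gt0//.
set a := Num.sqrt (_ + _); set b := Num.sqrt ((x - t) ^+ 2 + _).
have b0 : 0 < b by rewrite sqrtr_gt0.
have yb : `|y| <= b.
  by rewrite -sqrtr_sqr ler_wsqrtr// lerDr sqr_ge0.
have xb : `|x - t| <= b.
  by rewrite -sqrtr_sqr ler_wsqrtr// lerDl sqr_ge0.
have ab : a <= b + `|s - t|.
  rewrite -[leRHS]ger0_norm ?addr_ge0 ?(ltW b0)// -sqrtr_sqr ler_wsqrtr//.
  have -> : (b + `|s - t|) ^+ 2 = b ^+ 2 + 2 * (b * `|s - t|) + `|s - t| ^+ 2 by ring.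
  rewrite sqr_sqrtr ?(ltW (sum_gt0 _))// real_normK ?num_real//.
  have : (x - t) * (t - s) <= b * `|s - t|.
    by rewrite (le_trans (ler_norm _))// normrM [`|t - s|]distrC ler_wpM2r.
  rewrite (_ : (x - s) ^+ 2 = (x - t) ^+ 2 + 2 * ((x - t) * (t - s)) + (s - t) ^+ 2);
    last by ring.
  lra.
have y_gt0 : 0 < `|y| by rewrite normr_gt0.
have ab1 : -1 < a / b - 1.
  have : 0 < a / b by rewrite divr_gt0// sqrtr_gt0.
  lra.
have := le_ln1Dx ab1; rewrite addrC subrK => /le_trans; apply.
apply: (@le_trans _ _ (`|s - t| / b)).
  by rewrite -[1](@divff _ b) ?gt_eqF// -mulrBl ler_pM2r ?invr_gt0//; lra.
by rewrite ler_wpM2l// lef_pV2 ?posrE.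
Qed.

(** A bound for the total variation of [axis_log] on [0, 6]: its least value is
    [ln |y|], and the distance to the pole is at most [|x| + 6] horizontally. *)
Definition axis_log_variation : R :=
  2 * (ln (Num.sqrt ((`|x| + 6) ^+ 2 + y ^+ 2)) - ln `|y|).

(** The function decreases up to [x] and increases after it, hence is, up to a
    constant, a sum of two monotone functions, whose increments telescope. *)
Lemma axis_log_variation_le (M : nat) (c : nat -> R) :
  (forall j, c j <= c j.+1) -> 0 <= c 0%N -> c M <= 6 ->
  \sum_(j < M) `|axis_log (c j.+1) - axis_log (c j)| <= axis_log_variation.
Proof.
move=> cle c0 cM.
pose A t := axis_log (Num.min t x); pose C t := axis_log (Num.max t x).
have AC t : axis_log t = A t + C t - axis_log x.
  by rewrite /A /C; case: (leP t x) => _; rewrite ?addrK// addrAC subrr add0r.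
have Ale s t : s <= t -> A t <= A s.
  move=> st; apply: H_le; rewrite !ger0_norm ?subr_ge0 ?ge_min ?lexx ?orbT//.
  by rewrite lerD2l lerN2 le_min !ge_min st lexx orbT.
have Cle s t : s <= t -> C s <= C t.
  move=> st; apply: H_le; rewrite !ler0_norm ?subr_le0 ?le_max ?lexx ?orbT//.
  by rewrite lerN2 lerD2l lerN2 ge_max !le_max st lexx orbT.
have step n : \sum_(j < n) `|axis_log (c j.+1) - axis_log (c j)| <=
    (A (c 0%N) - A (c n)) + (C (c n) - C (c 0%N)).
  elim: n => [|n IH]; first by rewrite big_ord0 !subrr addr0.
  rewrite big_ord_recr/=; have a1 := Ale _ _ (cle n); have a2 := Cle _ _ (cle n).
  have : `|axis_log (c n.+1) - axis_log (c n)| <=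
      (A (c n) - A (c n.+1)) + (C (c n.+1) - C (c n)).
    by rewrite (AC (c n.+1)) (AC (c n)) ler_norml; apply/andP; split; lra.
  by move: IH; lra.
apply: (le_trans (step M)).
have H0 u : ln `|y| <= H u.
  have -> : ln `|y| = H 0 by rewrite /H expr0n add0r sqrtr_sqr.
  by apply: H_le; rewrite normr0.
have Hx u : `|u| <= `|x| + 6 -> H u <= ln (Num.sqrt ((`|x| + 6) ^+ 2 + y ^+ 2)).
  by move=> ux; apply: H_le; rewrite [leRHS]ger0_norm// addr_ge0.
have b1 : A (c 0%N) <= ln (Num.sqrt ((`|x| + 6) ^+ 2 + y ^+ 2)).
  apply: Hx; rewrite ger0_norm ?subr_ge0 ?ge_min ?lexx ?orbT//.
  have := ler_norm x; have := normr_ge0 x.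
  by have [] := leP (c 0%N) x; lra.
have b2 : C (c M) <= ln (Num.sqrt ((`|x| + 6) ^+ 2 + y ^+ 2)).
  apply: Hx; rewrite ler0_norm ?subr_le0 ?le_max ?lexx ?orbT//.
  have := ler_norm (- x); rewrite normrN; have := normr_ge0 x.
  by have [] := leP (c M) x; lra.
have b3 : ln `|y| <= A (c M) := H0 _.
have b4 : ln `|y| <= C (c 0%N) := H0 _.
by rewrite /axis_log_variation; lra.
Qed.

(** With [s ^ 2 = 1 + x ^ 2 + y ^ 2], the logarithm is dominated by a multiple of
    [sqrt (s / |y|)], while the Fubini-Study density is [1 / (pi s ^ 4)]; this
    leaves enough decay to separate the two variables. *)
Lemma axis_log_variation_fs :
  axis_log_variation * fs_density (x, y) <= 24 / pi * (1 + x ^+ 2)^-1 * kern y.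
Proof.
rewrite /fs_density /modulus /kern /=.
rewrite sqr_sqrtr ?addr_ge0 ?sqr_ge0// addrA.
set S := 1 + x ^+ 2 + y ^+ 2; pose s := Num.sqrt S.
have x2 : 0 <= x ^+ 2 := sqr_ge0 x.
have S0 : 0 < S by rewrite /S; have := yy_gt0; lra.
have S1 : 1 <= S by rewrite /S; have := yy_gt0; lra.
have s1 : 1 <= s by rewrite -sqrtr1 ler_wsqrtr.
have s0 : 0 < s by apply: lt_le_trans s1.
have ss : s ^+ 2 = S by rewrite sqr_sqrtr// ltW.
have y_gt0 : 0 < `|y| by rewrite normr_gt0.
have ys : `|y| <= s.
  by rewrite -sqrtr_sqr ler_wsqrtr// /S lerDr addr_ge0.
pose a := Num.sqrt (s / `|y|).
have a0 : 0 < a by rewrite sqrtr_gt0 divr_gt0.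
have V12 : axis_log_variation <= 12 * (s / Num.sqrt `|y|).
  have r0 : 0 < Num.sqrt ((`|x| + 6) ^+ 2 + y ^+ 2) by rewrite sqrtr_gt0.
  have rs : Num.sqrt ((`|x| + 6) ^+ 2 + y ^+ 2) <= 9 * s.
    have -> : 9 * s = Num.sqrt (81 * S).
      rewrite sqrtrM// -/s; congr (_ * _).
      by rewrite -[81](_ : 9 ^+ 2 = 81 :> R) ?sqrtr_sqr ?ger0_norm// -natrX.
    rewrite ler_wsqrtr//.
    have : (`|x| + 6) ^+ 2 <= 2 * x ^+ 2 + 72.
      rewrite -(real_normK (num_real x)) -subr_ge0.
      by rewrite (_ : _ - _ = (`|x| - 6) ^+ 2) ?sqr_ge0//; ring.
    by rewrite /S; have := yy_gt0; lra.
  have a9 : 9 * s / `|y| = (3 * a) ^+ 2.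
    by rewrite exprMn sqr_sqrtr ?divr_ge0 ?(ltW s0)//; field; rewrite gt_eqF.
  have a3 : 0 < 3 * a by rewrite mulr_gt0.
  apply: (@le_trans _ _ (4 * ln (3 * a))).
    rewrite /axis_log_variation -ln_div ?posrE//.
    rewrite (_ : 4 * ln (3 * a) = 2 * ln ((3 * a) ^+ 2)); last first.
      by rewrite lnXn// -[ln _ *+ 2]mulr_natl mulrA -natrM.
    rewrite ler_pM2l// ler_ln ?posrE ?divr_gt0 ?exprn_gt0//.
    by rewrite -a9 ler_pM2r ?invr_gt0.
  apply: (@le_trans _ _ (4 * (3 * a))).
    by rewrite ler_pM2l// ltW// ln_sublinear.
  rewrite /a sqrtrM ?(ltW s0)// sqrtrV ?(ltW y_gt0)//.
  have : Num.sqrt s <= s.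
    rewrite -[leRHS]ger0_norm ?(ltW s0)// -sqrtr_sqr ler_wsqrtr// expr2.
    by rewrite ler_peMr// ltW.
  have iy : 0 <= (Num.sqrt `|y|)^-1 by rewrite invr_ge0 sqrtr_ge0.
  move=> /(ler_wpM2r iy); lra.
have sy : 0 < Num.sqrt `|y| by rewrite sqrtr_gt0.
have p0 := @pi_gt0 R.
apply: (@le_trans _ _ (12 * (s / Num.sqrt `|y|) * (pi * S ^+ 2)^-1)).
  by rewrite ler_wpM2r// invr_ge0 mulr_ge0 ?sqr_ge0// ltW.
have X0 : 0 < 1 + x ^+ 2 by rewrite ltr_pwDl.
have Y0 : 0 < 1 + `|y| by rewrite addr_gt0.
have key : (1 + x ^+ 2) * (1 + `|y|) <= 2 * (S * s).
  rewrite (_ : 2 * (S * s) = S * (2 * s)); last by ring.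
  by apply: ler_pM; rewrite ?(ltW X0) ?(ltW Y0)//; [rewrite /S; have := yy_gt0; lra|lra].
have -> : 12 * (s / Num.sqrt `|y|) * (pi * S ^+ 2)^-1 =
    24 / (pi * Num.sqrt `|y|) * (2 * (S * s))^-1.
  rewrite -ss; move: (pi : R) p0 => P P0.
  by field; rewrite !gt_eqF.
have -> : 24 / pi / (1 + x ^+ 2) / (Num.sqrt `|y| * (1 + `|y|)) =
    24 / (pi * Num.sqrt `|y|) * ((1 + x ^+ 2) * (1 + `|y|))^-1.
  move: (pi : R) p0 => P P0.
  by field; rewrite !gt_eqF.
rewrite ler_pM2l ?divr_gt0 ?mulr_gt0//.
by rewrite lef_pV2 ?posrE ?mulr_gt0.
Qed.

End logarithm_on_the_axis.

(** * Distance of potentials *)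

Section potentials.
Context {R : realType}.
Context (m1 m2 : {measure set (R * R) -> \bar R}) (L1 L2 : R -> R) (K : R).
Context (mL1 : forall t, m1 (real_axis @` `]-oo, t]) = (L1 t)%:E).
Context (mL2 : forall t, m2 (real_axis @` `]-oo, t]) = (L2 t)%:E).
Context (L10 : L1 0 = 0) (L20 : L2 0 = 0) (L16 : L1 6 = 1) (L26 : L2 6 = 1).
Context (m1T : m1 setT = 1%E) (m2T : m2 setT = 1%E).
Context (LK : forall t, `|L1 t - L2 t| <= K) (K0 : 0 < K).

Let measurable_modulus (z : R * R) :
  measurable_fun setT (fun w : R * R => modulus (z - w)).
Proof.
rewrite /modulus; apply: measurableT_comp.
  by apply: continuous_measurable_fun; exact: sqrt_continuous.
apply: measurable_funD; apply: measurable_funX; apply: measurable_funB.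
- exact: measurable_cst.
- exact: measurable_fst.
- exact: measurable_cst.
- exact: measurable_snd.
Qed.

(** Refining the grid removes the oscillation, by [axis_log_lip], and leaves the
    total variation. *)
Lemma log_potential_close (z : R * R) : z.2 != 0 -> exists I1 I2 : R,
  [/\ log_potential m1 z = I1%:E, log_potential m2 z = I2%:E &
      `|I1 - I2| <= K * axis_log_variation z.1 z.2].
Proof.
case: z => x y /= y0.
pose f (w : R * R) : \bar R := lne (modulus ((x, y) - w))%:E.
have mf : measurable_fun setT f.
  by apply: measurable_lne_fun; exact: measurable_modulus.
have fh t : 0 < t <= 6 -> f (real_axis t) = (axis_log x y t)%:E.
  have E : modulus ((x, y) - real_axis t) = Num.sqrt ((x - t) ^+ 2 + y ^+ 2).
    by rewrite /modulus /= subr0.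
  move=> _; rewrite /f E lne_EFin// sqrtr_gt0.
  by rewrite ltr_wpDl ?sqr_ge0// exprn_even_gt0.
have yn : 0 < `|y| by rewrite normr_gt0.
have cmp M : exists I1 I2 : R, [/\ (\int[m1]_w f w = I1%:E)%E,
    (\int[m2]_w f w = I2%:E)%E &
    `|I1 - I2| <= 2 * (6 / M.+1%:R / `|y|) + K * axis_log_variation x y].
  have [s t s0 st ts|I1 [I2 [E1 E2 I12]]] := compare_integrals mL1 mL2 L10 L20
      L16 L26 m1T m2T LK mf (ltn0Sn M) fh (w := 6 / M.+1%:R / `|y|).
    apply: (le_trans (axis_log_lip x y0 s t)).
    rewrite ler_pM2r ?invr_gt0// distrC ger0_norm// subr_ge0.
    by case/andP: st.
  exists I1, I2; split => //; apply: (le_trans I12); rewrite lerD2l.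
  rewrite ler_pM2l//.
  apply: (axis_log_variation_le x y0 (M := M.+1)
      (c := fun j => 6 * (j%:R / M.+1%:R))).
  - by move=> j; rewrite ler_pM2l// ler_pM2r ?invr_gt0// ler_nat.
  - by rewrite mul0r mulr0.
  - by rewrite divff ?mulr1.
have [I1 [I2 [E1 E2 _]]] := cmp 0%N.
exists I1, I2; split => //.
apply/ler_addgt0Pr => e e0.
have [M Me] : exists M : nat, 2 * (6 / M.+1%:R / `|y|) <= e.
  have := truncnS_gt (12 / (e * `|y|)); set n := Num.truncn _ => H.
  exists n; have M0 : 0 < n.+1%:R :> R by rewrite ltr0n.
  move: H M0; move: (n.+1%:R) => M + M0.
  rewrite ltr_pdivrMr ?mulr_gt0// => /ltW h.
  rewrite (_ : 2 * _ = 12 / (M * `|y|)); last first.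
    by field; rewrite !gt_eqF.
  by rewrite ler_pdivrMr ?mulr_gt0// mulrCA.
have [J1 [J2 [F1 F2 J12]]] := cmp M.
have -> : I1 = J1 by move: E1; rewrite /log_potential F1 => -[].
have -> : I2 = J2 by move: E2; rewrite /log_potential F2 => -[].
by apply: (le_trans J12); rewrite addrC lerD2l.
Qed.

Lemma fs_density_ge0 (z : R * R) : 0 <= fs_density z.
Proof. by rewrite invr_ge0 mulr_ge0 ?pi_ge0 ?sqr_ge0. Qed.

Lemma dist_le_cdf : (dist m1 m2 <= (K * (48 * pi))%:E)%E.
Proof.
pose G1 (x : R) : \bar R := (K * (24 / pi * (1 + x ^+ 2)^-1))%:E.
pose G (z : R * R) : \bar R := (G1 z.1 * ekern z.2)%E.
have p0 := @pi_gt0 R.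
have oneD (x : R) : 0 < 1 + x ^+ 2 by rewrite ltr_pwDl// sqr_ge0.
have G1_gt0 x : (0 < G1 x)%E.
  by rewrite lte_fin !mulr_gt0 ?invr_gt0.
have mG1 : measurable_fun [set: R] G1.
  apply/measurable_EFinP; apply: continuous_measurable_fun => x.
  by apply: cvgMr; apply: cvgMr; exact: continuous_oneDsqrV.
apply: (@le_trans _ _
    (\int[(@lebesgue_measure R) \x (@lebesgue_measure R)]_z G z)%E).
  apply: le_integral_majorant => [z|[x y]].
    by rewrite mule_ge0// lee_fin fs_density_ge0.
  rewrite /G /ekern /=; case: eqP => [->|/eqP y0].
    by rewrite gt0_muley ?G1_gt0// leey.
  have [I1 [I2 [-> -> I12]]] := @log_potential_close (x, y) y0.
  rewrite -EFinB abse_EFin -EFinM -EFinM lee_fin.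
  apply: (le_trans (ler_wpM2r (fs_density_ge0 (x, y)) I12)).
  have := axis_log_variation_fs x y0; rewrite -!mulrA => h.
  by rewrite ler_pM2l//=.
rewrite fubini_tonelli1//; last 2 first.
- apply: emeasurable_funM.
    by apply: measurableT_comp mG1 _; exact: measurable_fst.
  by apply: measurableT_comp (@measurable_ekern R) _; exact: measurable_snd.
- by move=> z; rewrite mule_ge0 ?ekern_ge0// ltW.
rewrite /fubini_F /G /=.
have J0 : (0 <= \int[@lebesgue_measure R]_y ekern y)%E.
  by apply: integral_ge0 => y _; exact: ekern_ge0.
have J1 := @integral_ekern R.
rewrite (@eq_integral _ (measurableTypeR R) R (@lebesgue_measure R) setT
    (fun x => G1 x * \int[@lebesgue_measure R]_y ekern y)%E); last first.
  move=> x _; rewrite ge0_integralZl//; last exact: ltW.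
    exact: measurable_ekern.
  by move=> y _; exact: ekern_ge0.
rewrite ge0_integralZr//; last by move=> x _; exact: ltW.
have -> : (\int[@lebesgue_measure R]_x G1 x = (K * 24)%:E)%E.
  rewrite (@eq_integral _ (measurableTypeR R) R (@lebesgue_measure R) setT
    (fun x => (K * (24 / pi))%:E * ((1 + x ^+ 2)^-1)%:E)%E); last first.
    by move=> x _; rewrite /G1 -EFinM mulrA.
  rewrite ge0_integralZl//.
  - by rewrite integral_inv_oneDsqr -EFinM -mulrA divfK// gt_eqF.
  - apply/measurable_EFinP; apply: continuous_measurable_fun => x.
    exact: continuous_oneDsqrV.
  - by move=> x _; rewrite lee_fin invr_ge0 ltW.
  - by rewrite lee_fin mulr_ge0 ?divr_ge0// ltW.
apply: (@le_trans _ _ ((K * 24)%:E * (2 * pi)%:E)%E).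
  by rewrite lee_pmul2l// lte_fin mulr_gt0.
by rewrite -EFinM lee_fin le_eqVlt; apply/orP; left; apply/eqP; ring.
Qed.

End potentials.

(** * Test functions on the sphere *)

Section hoelder_on_the_axis.
Context {R : realType}.
Implicit Types (F : R * R -> R) (gamma : R).

Let D : set (R * R) := [set z | modulus z < 2].

Let modulus_axis (t : R) : modulus (t, 0) = `|t|.
Proof. by rewrite /modulus /= expr0n addr0 sqrtr_sqr. Qed.

Let axis_in_D (t : R) : -2 < t -> t < 2 -> D (t, 0).
Proof. by move=> t1 t2; rewrite /D /= modulus_axis ltr_norml t1. Qed.

Let sup_norm_ge0 F : (0 <= sup_norm D F)%E.
Proof.
apply: (@le_trans _ _ `|F (0, 0)|%:E); first by rewrite lee_fin.
by apply: ereal_sup_ubound; exists (0, 0) => //; apply: axis_in_D; lra.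
Qed.

Let seminorm_ge0 theta F : (0 <= hoelder_seminorm D theta F)%E.
Proof.
apply: (@le_trans _ _ (`|F (0, 0) - F (1, 0)| / modulus ((0, 0) - (1, 0)) `^ theta)%:E).
  by rewrite lee_fin divr_ge0// powR_ge0.
apply: ereal_sup_ubound; exists (0, 0), (1, 0); split => //.
- by apply: axis_in_D; lra.
- by apply: axis_in_D; lra.
- by move=> [] /eqP; rewrite eq_sym oner_eq0.
Qed.

Let le_sum_term n (P : pred 'I_n) (T : 'I_n -> \bar R) (i : 'I_n) : P i ->
  (forall j, 0 <= T j)%E -> (T i <= \sum_(j < n | P j) T j)%E.
Proof. by move=> Pi T0; rewrite (bigD1 i)//= leeDl// sume_ge0. Qed.

Let sums_ge0 n F : (0 <= \sum_(i < n.+1) \sum_(j < n.+1 | (i + j <= n)%N)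
   sup_norm D (pd i j F))%E.
Proof. by apply: sume_ge0 => i _; apply: sume_ge0 => j _; exact: sup_norm_ge0. Qed.

Lemma sup_norm_le_hoelder gamma F (i j : nat) : (i + j <= Num.truncn gamma)%N ->
  (sup_norm D (pd i j F) <= hoelder_norm gamma D F)%E.
Proof.
move=> ij; rewrite /hoelder_norm.
set k := Num.truncn gamma in ij *.
have ik : (i < k.+1)%N by rewrite ltnS (leq_trans (leq_addr j i)).
have jk : (j < k.+1)%N by rewrite ltnS (leq_trans (leq_addl i j)).
apply: (@le_trans _ _ (\sum_(i < k.+1) \sum_(j < k.+1 | (i + j <= k)%N)
   sup_norm D (pd i j F))%E); last first.
  rewrite leeDl//; case: ifP => // _; apply: sume_ge0 => i' _.
  exact: seminorm_ge0.
apply: le_trans (@le_sum_term k.+1 predT _ (Ordinal ik) isT _); last first.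
  by move=> i'; apply: sume_ge0 => j' _; exact: sup_norm_ge0.
apply: (@le_sum_term k.+1 (fun j' => (i + j' <= k)%N)
  (fun j' => sup_norm D (pd i j' F)) (Ordinal jk)) => //.
Qed.

Lemma seminorm_le_hoelder gamma F : 0 < gamma -> gamma < 1 ->
  (hoelder_seminorm D gamma F <= hoelder_norm gamma D F)%E.
Proof.
move=> g0 g1; rewrite /hoelder_norm.
have -> : Num.truncn gamma = 0%N by apply/truncn0Pn; rewrite -ltNge.
rewrite subr0 gt_eqF// [X in (_ <= _ + X)%E]big_ord1 /=.
by rewrite leeDr//; exact: (sums_ge0 0).
Qed.

Let axis_derive F (t : R) : derivable F (t, 0) (1, 0) ->
  is_derive t (1 : R) (fun s => F (s, 0)) ('D_(1, 0) F (t, 0)).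
Proof.
move=> dF.
have E : (fun h : R => h^-1 *: (((fun s => F (s, 0)) \o shift t) (h *: (1 : R)) - F (t, 0))) =
         (fun h : R => h^-1 *: ((F \o shift ((t, 0) : R * R)) (h *: ((1, 0) : R * R)) - F (t, 0))).
  apply/funext => h; congr (_ *: (F _ - _)).
  by apply: injective_projections => //=; rewrite /GRing.scale/= mulr0 addr0.
split; first by rewrite /derivable E.
by rewrite /derive E.
Qed.

(** For exponents below 1 this is the seminorm; from 1 on, the bound on the
    first derivative already gives a Lipschitz function. *)
Lemma axis_hoelder gamma F : 0 < gamma ->
  class_Ck (Num.truncn gamma) F -> (hoelder_norm gamma D F <= 1)%E ->
  forall s t : R, -2 < s -> s <= t -> t < 2 ->
  `|F (s, 0) - F (t, 0)| <= (t - s) `^ Num.min gamma 1.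
Proof.
move=> g0 CF F1 s t s2 st t2.
have [->|stn] := eqVneq s t.
  by rewrite !subrr normr0 powR_ge0.
have st' : 0 < t - s by rewrite subr_gt0 lt_neqAle stn.
have [g1|g1] := ltP gamma 1.
  have := le_trans (seminorm_le_hoelder F g0 g1) F1.
  have /ereal_sup_ubound/le_trans/[apply] : [set e | exists z w,
     [/\ D z, D w, z <> w & e = (`|F z - F w| / modulus (z - w) `^ gamma)%:E]]
      (`|F (s, 0) - F (t, 0)| / modulus ((s, 0) - (t, 0)) `^ gamma)%:E.
    exists (s, 0), (t, 0); split => //.
    - by apply: axis_in_D => //; exact: le_lt_trans t2.
    - by apply: axis_in_D => //; exact: lt_le_trans st.
    - by move=> [] /eqP; exact/negP.
  have -> : modulus ((s, 0) - (t, 0)) = t - s.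
    rewrite (_ : _ - _ = (s - t, 0)) ?modulus_axis; last first.
      by congr (_, _); rewrite /= subr0.
    by rewrite distrC gtr0_norm.
  by rewrite lee_fin ler_pdivrMr ?powR_gt0// mul1r.
rewrite powRr1 ?(ltW st')//.
have k1 : (0 < Num.truncn gamma)%N by rewrite truncn_gt0.
have dF z : derivable F z (1, 0).
  by case: (Num.truncn gamma) k1 CF => //= n _ [_ []].
have dF1 z : D z -> `|'D_(1, 0) F z| <= 1.
  move=> Dz; rewrite -lee_fin.
  have h := @sup_norm_le_hoelder gamma F 1 0 k1.
  apply: le_trans (le_trans h F1).
  by apply: ereal_sup_ubound; exists z.
have [||c] := @MVT_segment _ (fun s => F (s, 0)) (fun s => 'D_(1, 0) F (s, 0)) s t st.
- by move=> u _; exact: axis_derive.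
- apply: derivable_within_continuous => u _.
  by have := axis_derive (dF (u, 0)) => h; exact: ex_derive.
rewrite in_itv/= => /andP[sc ct] e.
rewrite distrC e normrM (gtr0_norm st') ler_piMl ?(ltW st')//.
by apply/dF1/axis_in_D; [exact: lt_le_trans sc|exact: le_lt_trans t2].
Qed.

End hoelder_on_the_axis.

Section test_functions.
Context {R : realType} (gamma : R) (gamma0 : 0 < gamma).
Context (varphi : one_point_compactification (R * R) -> R).
Context (cphi : sphere_class gamma varphi) (phi1 : (sphere_norm gamma varphi <= 1)%E).

Let f (t : R) : R := varphi (Some (t, 0)).

(** The two charts cover overlapping parts of the positive half-line, on which
    they differ by the inversion, a contraction on [1, +oo[. *)
Lemma test_function_hoelder (s t : R) : 0 <= s -> s <= t -> t - s <= 2^-1 ->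
  `|f s - f t| <= (t - s) `^ Num.min gamma 1.
Proof.
move=> s0 st ts; case: cphi => C0 Coo _.
move: phi1; rewrite /sphere_norm ge_max => /andP[N0 Noo].
have [t2|t2] := ltP t 2.
  by apply: (axis_hoelder gamma0 C0 N0) => //; lra.
have s1 : 1 <= s by lra.
have s_gt0 : 0 < s by lra.
have t_gt0 : 0 < t by lra.
have fE (u : R) : 0 < u -> f u = chart_oo varphi (u^-1, 0).
  move=> u0; rewrite /f /chart_oo; case: ifP => [/eqP[] /eqP|_].
    by rewrite invr_eq0 gt_eqF.
  congr (varphi (Some _)); rewrite /plane_inv /modulus /= expr0n addr0.
  rewrite sqrtr_sqr real_normK ?num_real// oppr0 mul0r; congr (_, _).
  by field; rewrite gt_eqF.
rewrite !fE// distrC.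
have ti : t^-1 <= s^-1 by rewrite lef_pV2 ?posrE.
have si : s^-1 < 2 by rewrite invf_plt ?posrE//; lra.
have t0 : -2 < t^-1 by rewrite (@lt_trans _ _ 0) ?invr_gt0//; lra.
apply: (le_trans (axis_hoelder gamma0 Coo Noo t0 ti si)).
have g0 : 0 <= Num.min gamma 1 by rewrite le_min ltW//=.
apply: ge0_ler_powR; rewrite ?nnegrE ?subr_ge0//.
have -> : s^-1 - t^-1 = (t - s) / (s * t) by field; rewrite !gt_eqF.
by rewrite ler_pdivrMr ?mulr_gt0// ler_peMr ?subr_ge0// mulr_ege1//; lra.
Qed.

Lemma measurable_test_function :
  measurable_fun setT (fun z : R * R => varphi (Some z)).
Proof.
apply: measurable_continuous_plane; case: cphi => C0 _ _.
by move: C0; case: (Num.truncn gamma) => [|n] [].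
Qed.

End test_functions.

(** * The three rates *)

Section rates.
Context {R : realType} (p : nat) (p2 : (2 <= p)%N).

Let p0 : 0 < p%:R :> R. Proof. by rewrite ltr0n; case: p p2. Qed.
Let lnp : 2^-1 <= ln p%:R :> R := ln_nat_ge_half p2.
Let lnp0 : 0 < ln p%:R :> R. Proof. by apply: lt_le_trans lnp; rewrite invr_gt0. Qed.

Let powR_inv (e : R) : p%:R^-1 `^ e = p%:R `^ (- e) :> R.
Proof. by rewrite -powR_inv1 ?ler0n// -powRrM mulN1r. Qed.

(** The quotient on the left is at most one. *)
Lemma log_rate_le (e : R) : e <= 1 ->
  ln p%:R / p%:R <= p%:R `^ (- e) * ln p%:R `^ e.
Proof.
move=> e1; rewrite -powR_inv -powRM ?(ltW lnp0) ?invr_ge0// mulrC.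
apply: ger1_powR => //; rewrite mulr_gt0 ?invr_gt0//=.
by rewrite mulrC ler_pdivrMr// mul1r ltW// ln_sublinear.
Qed.

(** For exponents below one, the factor [p ^ (- gamma / 2)] in excess absorbs the
    logarithm; from one on, [log_rate_le] applies. *)
Lemma hoelder_rate_le (gamma : R) : 0 < gamma <= 2 ->
  p%:R^-1 `^ Num.min gamma 1 * (2 + 54 * ln p%:R) <=
  232 / gamma * p%:R `^ (- (gamma / 2)) * ln p%:R `^ (gamma / 2).
Proof.
move=> /andP[g0 g2]; set w := _ `^ _.
have w0 : 0 <= w by exact: powR_ge0.
have h0 : 0 < gamma / 2 by rewrite divr_gt0.
have h1 : gamma / 2 <= 1 by rewrite ler_pdivrMr// mul1r.
set V := p%:R `^ (- (gamma / 2)) * ln p%:R `^ (gamma / 2).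
have V0 : 0 <= V by rewrite mulr_ge0// powR_ge0.
suff : w * ln p%:R <= 4 / gamma * V.
  move=> wl; have h : w * 1 <= w * (2 * ln p%:R) by rewrite ler_wpM2l//; have := lnp; lra.
  by rewrite -[leRHS]mulrA -/V; lra.
have ig : 1 <= 2 / gamma by rewrite ler_pdivlMr// mul1r.
rewrite /w; have [g1|g1] := ltP gamma 1.
  have lnle : ln p%:R <= 2 / gamma * p%:R `^ (gamma / 2).
    rewrite mulrC -ler_pdivrMr ?divr_gt0// invf_div mulrC -ln_powR.
    by rewrite ltW// ln_sublinear// powR_gt0.
  have half : 2^-1 <= ln p%:R `^ (gamma / 2).
    apply: (@le_trans _ _ (2^-1 `^ (gamma / 2))).
      by apply: ger1_powR => //; rewrite invr_gt0 ltr0n invf_le1 ?ler1n.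
    by apply: ge0_ler_powR; rewrite ?nnegrE ?(ltW h0) ?(ltW lnp0) ?invr_ge0.
  rewrite powR_inv.
  apply: (@le_trans _ _ (p%:R `^ (- gamma) * (2 / gamma * p%:R `^ (gamma / 2)))).
    by rewrite ler_wpM2l// powR_ge0.
  have -> : p%:R `^ (- gamma) * (2 / gamma * p%:R `^ (gamma / 2)) =
      2 / gamma * p%:R `^ (- (gamma / 2)) :> R.
    rewrite mulrCA -powRD; last by apply/implyP => _; rewrite gt_eqF.
    by congr (_ * _ `^ _); lra.
  have -> : 4 / gamma * V =
      2 / gamma * p%:R `^ (- (gamma / 2)) * (2 * ln p%:R `^ (gamma / 2)).
    by rewrite /V; ring.
  rewrite ler_peMr ?mulr_ge0 ?powR_ge0 ?invr_ge0 ?(ltW g0)//; lra.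
rewrite powRr1 ?invr_ge0// mulrC.
apply: (le_trans (log_rate_le h1)); rewrite -/V.
by rewrite ler_peMl//; lra.
Qed.

End rates.

Section laguerre_vs_marchenko_pastur.
Context {R : realType} (p : nat) (alpha : R).
Context (alpha0 : 0 < alpha) (p2 : (2 <= p)%N).
Let phi : R := p%:R / (p%:R + alpha).
Let mu := laguerre_measure p alpha.
Let nu := mp_measure phi.
Let K : R := 9 * (ln p%:R / p%:R).

Let p0 : 0 < p%:R :> R. Proof. by rewrite ltr0n; case: p p2. Qed.
Let K0 : 0 < K.
Proof.
rewrite mulr_gt0// divr_gt0//.
by apply: lt_le_trans (ln_nat_ge_half p2); rewrite invr_gt0.
Qed.

Let L1 (t : R) : R := fine (mu (real_axis @` `]-oo, t])).
Let L2 (t : R) : R := fine (nu (real_axis @` `]-oo, t])).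

Let mL1 t : mu (real_axis @` `]-oo, t]) = (L1 t)%:E.
Proof.
have [x [y [xE _ _]]] := kolmogorov alpha0 p2 (BRight t).
by rewrite /L1 [mu _]xE.
Qed.

Let mL2 t : nu (real_axis @` `]-oo, t]) = (L2 t)%:E.
Proof.
have [x [y [_ yE _]]] := kolmogorov alpha0 p2 (BRight t).
by rewrite /L2 [nu _]yE.
Qed.

Let LK t : `|L1 t - L2 t| <= K.
Proof.
have [x [y [xE yE xy]]] := kolmogorov alpha0 p2 (BRight t).
by rewrite /L1 /L2 [mu _]xE [nu _]yE.
Qed.

Let L10 : L1 0 = 0. Proof. by rewrite /L1 [mu _](laguerre_cdf01 alpha0 p2).1. Qed.
Let L16 : L1 6 = 1. Proof. by rewrite /L1 [mu _](laguerre_cdf01 alpha0 p2).2. Qed.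
Let L20 : L2 0 = 0. Proof. by rewrite /L2 [nu _](mp_cdf01 alpha0 p2).1. Qed.
Let L26 : L2 6 = 1. Proof. by rewrite /L2 [nu _](mp_cdf01 alpha0 p2).2. Qed.
Let muT : mu setT = 1%E. Proof. exact: laguerre_measureT. Qed.
Let nuT : nu setT = 1%E. Proof. exact: mp_measureT. Qed.

Lemma dist_laguerre_mp : (dist mu nu <= (1728 * p%:R^-1 * ln p%:R)%:E)%E.
Proof.
apply: (le_trans (dist_le_cdf mL1 mL2 L10 L20 L16 L26 muT nuT LK K0)).
rewrite lee_fin /K.
have -> : 9 * (ln p%:R / p%:R) * (48 * pi) = 432 * (ln p%:R / p%:R) * pi :> R by ring.
have -> : 1728 * p%:R^-1 * ln p%:R = 432 * (ln p%:R / p%:R) * 4 :> R by ring.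
apply: ler_wpM2l; last exact: ltW (@pi_lt4 R).
by have := ltW K0; rewrite /K; lra.
Qed.

Lemma dist_gamma_laguerre_mp (gamma : R) : 0 < gamma <= 2 ->
  (dist_gamma gamma mu nu <=
   (232 / gamma * p%:R `^ (- (gamma / 2)) * ln p%:R `^ (gamma / 2))%:E)%E.
Proof.
move=> /[dup] g02 /andP[g0 _].
apply: ge_ereal_sup => _ [varphi [cphi phi1 ->]].
pose w : R := p%:R^-1 `^ Num.min gamma 1.
have g1 : 0 <= Num.min gamma 1 by rewrite le_min (ltW g0) ler01.
(* A grid of [6 p] cells of length [1 / p] balances the oscillation and the
   number of increments. *)
have p6 : (0 < 6 * p)%N by case: p p2.
have step (s t : R) : 0 <= s -> s <= t -> t - s <= p%:R^-1 ->
    `|varphi (Some (s, 0)) - varphi (Some (t, 0))| <= w.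
  move=> s0 st ts.
  have ts2 : t - s <= 2^-1.
    by rewrite (le_trans ts)// lef_pV2 ?posrE// ler_nat.
  apply: (le_trans (test_function_hoelder g0 cphi phi1 s0 st ts2)).
  by apply: ge0_ler_powR => //; rewrite nnegrE ?subr_ge0// invr_ge0 ltW.
have mesh : 6 / (6 * p)%:R = p%:R^-1 :> R.
  by rewrite natrM; field; rewrite gt_eqF.
have mphi : measurable_fun setT (fun z : R * R => (varphi (Some z))%:E).
  by apply/measurable_EFinP; exact: measurable_test_function cphi.
have [s t s0 /andP[st _]|I1 [I2 [-> -> I12]]] := compare_integrals
    mL1 mL2 L10 L20 L16 L26 muT nuT LK
    (f := fun z => (varphi (Some z))%:E) (h := fun t => varphi (Some (t, 0)))
    (w := w) mphi p6 (fun _ _ => erefl).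
  by rewrite mesh => ts; exact: step.
rewrite -EFinB abse_EFin lee_fin; apply: (le_trans I12).
apply: le_trans (hoelder_rate_le p2 g02); rewrite -/w.
set S := \sum_(_ < _) _.
have S_le : S <= 6 * p%:R * w.
  apply: (@le_trans _ _ (\sum_(j < 6 * p) w)); last first.
    by rewrite sumr_const card_ord -[w *+ _]mulr_natl natrM.
  apply: ler_sum => j _; rewrite distrC; apply: step.
  - by rewrite mulr_ge0// divr_ge0.
  - by rewrite ler_pM2l// ler_pM2r ?invr_gt0 ?ltr0n// ler_nat.
  - have e : j.+1%:R - j%:R = 1 :> R by rewrite -[j.+1%:R]natr1 addrAC subrr add0r.
    by rewrite -mulrBr -mulrBl e mul1r mesh.
have : K * S <= K * (6 * p%:R * w) by rewrite ler_pM2l.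
have -> : K * (6 * p%:R * w) = 54 * ln p%:R * w.
  by rewrite /K; field; rewrite gt_eqF.
by rewrite mulrDr; lra.
Qed.

Let itv_measure (m : {measure set (R * R) -> \bar R}) (l u : itv_bound R) (a b : R) :
  (l <= u)%O -> m (real_axis @` left_of l) = a%:E ->
  m (real_axis @` left_of u) = b%:E ->
  m (real_axis @` [set` Interval l u]) = (b - a)%:E.
Proof.
move=> lu la ub.
have E : real_axis @` left_of u =
    real_axis @` left_of l `|` real_axis @` [set` Interval l u].
  by rewrite -image_setU left_of_itv setDUK//; exact: left_of_le.
have disj : real_axis @` left_of l `&` real_axis @` [set` Interval l u] = set0.
  apply/seteqP; split=> // _ [[x xl <-] [y + [yx]]].
  by rewrite yx left_of_itv => -[_ /(_ xl)].
have : (b%:E = a%:E + m (real_axis @` [set` Interval l u]))%E.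
  rewrite -ub -la E; apply: measureU => //; apply: measurable_axis_image.
    exact: measurable_left_of.
  exact: measurable_itv.
case: (m _) => [c||] //; rewrite -EFinD => -[->].
by congr (_%:E); lra.
Qed.

Lemma interval_laguerre_mp (c : R) (I : interval R) : 18 <= c ->
  (`|mu (real_axis @` [set` I]) - nu (real_axis @` [set` I])| <=
   (c * (1 - phi)^-1 * p%:R `^ (- 2^-1) * ln p%:R `^ (2^-1))%:E)%E.
Proof.
move=> c18; have c0 : 0 < c by apply: lt_le_trans c18.
have N0 : 0 < p%:R + alpha by rewrite addr_gt0.
have phi01 : 0 < 1 - phi <= 1.
  rewrite gerBl divr_ge0 ?(ltW p0) ?(ltW N0)// andbT subr_gt0.
  by rewrite ltr_pdivrMr// mul1r ltrDl.
have lp := ln_nat_ge_half (R := R) p2.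
have rate := @log_rate_le R p p2 2^-1.
case/andP: phi01 => phi0 phi1.
have rhs : 2 * K <= c * (1 - phi)^-1 * p%:R `^ (- 2^-1) * ln p%:R `^ (2^-1).
  have i1 : 1 <= (1 - phi)^-1 by rewrite invf_ge1.
  have l0 : 0 <= ln p%:R / p%:R :> R.
    by rewrite divr_ge0 ?(ltW p0)//; apply: le_trans lp; rewrite invr_ge0.
  have cl : c * (ln p%:R / p%:R) <= c * (1 - phi)^-1 * (ln p%:R / p%:R).
    by apply: ler_wpM2r => //; apply: ler_peMr => //; exact: ltW.
  apply: (@le_trans _ _ (c * (1 - phi)^-1 * (ln p%:R / p%:R))).
    apply: le_trans cl; rewrite /K mulrA; apply: ler_wpM2r => //.
    by apply: le_trans c18; rewrite -natrM.
  rewrite -[leRHS]mulrA; apply: ler_wpM2l; last first.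
    by apply: rate; rewrite invf_le1 ?ler1n.
  by rewrite mulr_ge0 ?(ltW c0)// (le_trans _ i1).
case: I => l u.
have [lu|lu] := boolP (l <= u)%O; last first.
  have -> : [set` Interval l u] = set0.
    apply/seteqP; split=> // x /=; rewrite itv_boundlr => /andP[lx xu].
    apply: (negP lu); apply: le_trans xu.
    by apply: (le_trans lx); rewrite bnd_simp.
  have n0 : nu set0 = 0%E by exact: measure0.
  rewrite image_set0 n0 measure0 sube0 abse0 lee_fin.
  by apply: le_trans rhs; rewrite mulr_ge0// ltW.
have [x [y [xE yE xy]]] := kolmogorov alpha0 p2 l.
have [x' [y' [x'E y'E xy']]] := kolmogorov alpha0 p2 u.
rewrite [X in `|X - _|%E](itv_measure lu xE x'E).
rewrite [X in `|_ - X|%E](itv_measure lu yE y'E).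
rewrite -EFinB abse_EFin lee_fin; apply: le_trans rhs.
move: xy xy'; rewrite -/K !ler_norml => /andP[? ?] /andP[? ?].
by apply/andP; split; lra.
Qed.

End laguerre_vs_marchenko_pastur.

Theorem corollary2p6 (R : realType) :
  exists c : R, 0 < c /\
  exists cg : R -> R, (forall gamma : R, 0 < gamma <= 2 -> 0 < cg gamma) /\
  forall (alpha : R) (p : nat), 0 < alpha -> (2 <= p)%N ->
    let phi : R := p%:R / (p%:R + alpha) in
    [/\ (dist (laguerre_measure p alpha) (mp_measure phi)
           <= (c * p%:R^-1 * ln p%:R)%:E)%E,
        forall gamma : R, 0 < gamma <= 2 ->
          (dist_gamma gamma (laguerre_measure p alpha) (mp_measure phi)
             <= (cg gamma * p%:R `^ (- (gamma / 2)) * ln p%:R `^ (gamma / 2))%:E)%E &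
        forall I : interval R,
          (`| laguerre_measure p alpha (real_axis @` [set` I])
              - mp_measure phi (real_axis @` [set` I]) |
             <= (c * (1 - phi)^-1 * p%:R `^ (- 2^-1) * ln p%:R `^ (2^-1))%:E)%E].

Proof.
exists 1728; split; first by rewrite ltr0n.
exists (fun gamma => 232 / gamma); split.
  by move=> gamma /andP[g0 _]; rewrite divr_gt0// ltr0n.
move=> alpha p alpha0 p2 phi; split.
- exact: dist_laguerre_mp.
- by move=> gamma; exact: dist_gamma_laguerre_mp.
- by move=> I; apply: interval_laguerre_mp => //; rewrite ler_nat.
Qed.
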